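(* Suppose that the KKT system (K) has a nonempty solution set $\mathbf K$ and that the self-adjoint operators $\mathcal D_i:\mathbb Y_i\to\mathbb Y_i$ satisfy $$\tfrac12\widehat\Sigma^f_{ii}+\sigma\mathcal F_i\mathcal F_i^*+\mathcal D_i\succ0\ (i=1,\dots,s)\quad\text{and}\quad\mathcal D:=\operatorname{Diag}(\mathcal D_1,\dots,\mathcal D_s)\succeq-\tfrac12\widehat\Sigma^f .$$ Let $\{u^k=(x^k,w^k)\}$ with $w^k:=(y^k;z^k)$ be a sequence generated by Algorithm sGS-iPADMM (with $\tau\in(0,2)$) such that $\{v^k:=(x^k,y^k,\Pi_{\operatorname{Range}(\mathcal G)}(z^k))\}$ converges to $v^*\in\mathbf K$. Then $$\operatorname{dist}_\Omega(u^k,\mathbf K)=\operatorname{dist}_\Omega(v^k,\mathbf K),\quad\forall k\ge0 .$$ Suppose further that $b-\mathcal Gx^0=0$ and $\gamma^k=0$ for all $k\ge0$; that the KKT residual mapping $\mathcal R$ is metric subregular at $v^*$ for $0$ with modulus $\kappa>0$, i.e., there exists $r>0$ such that $\operatorname{dist}(u,\mathbf K)\le\kappa\|\mathcal R(u)\|$ for all $u\in\mathbb X\times\mathbb Y\times\mathbb Z$ with $\|u-v^*\|\le r$; and that, for a given sequence $\{\tilde\eta_k\}$ of nonnegative numbers converging to $0$, in addition to $\max\{\|\tilde\delta_i^k\|,\|\delta_i^k\|\mid i=1,\dots,s\}\le\tilde\varepsilon_k$, there exists an integer $k_0>0$ such that for all $k\ge k_0$ $$\max_{1\le i\le s}\{\|\tilde\delta_i^k\|,\|\delta_i^k\|\}\le\tilde\eta_k\|v^k-v^{k+1}\|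 .$$ Then there exist nonnegative numbers $\vartheta_k$ with $\sup_{k\ge k_0}\vartheta_k<1$ such that for all $k$ sufficiently large $$\operatorname{dist}_\Omega(u^{k+1},\mathbf K)\le\vartheta_k\operatorname{dist}_\Omega(u^k,\mathbf K),$$ i.e., the convergence rate of $\operatorname{dist}_\Omega(u^k,\mathbf K)$ is Q-linear when $k$ is sufficiently large.
   Context: $\mathbb X$, $\mathbb Y=\mathbb Y_1\times\cdots\times\mathbb Y_s$, $\mathbb Z$ are finite-dimensional real Hilbert spaces. For self-adjoint $\mathcal O$, $\|\nu\|_{\mathcal O}^2:=\langle\nu,\mathcal O\nu\rangle$ (also if $\mathcal O$ is indefinite). $\dagger$ is the Moore–Penrose pseudoinverse; $\Pi_H$ is the metric projection onto $H$; $\operatorname{dist}$ is the distance to a set. For closed proper convex $\theta$, $\operatorname{Prox}_\theta(\nu):=\operatorname{argmin}_{\nu'}\{\theta(\nu')+\tfrac12\|\nu-\nu'\|^2\}$. Problem: $\min_{y\in\mathbb Y,z\in\mathbb Z}\{p(y_1)+f(y)-\langle b,z\rangle\mid\mathcal F^*y+\mathcal G^*z=c\}$, with $p:\mathbb Y_1\to(-\infty,+\infty]$ closed proper convex, $f:\mathbb Y\to\mathbb R$ convex, continuously differentiable with Lipschitz gradient, $\mathcal F:\mathbb X\to\mathbb Y$, $\mathcal G:\mathbb X\to\mathbb Z$ linear, $b\in\mathbb Z$, $c\in\mathbb X$. Write $\mathcal Fx=(\mathcal F_1x;\dots;\mathcal F_sx)$ with $\mathcal F_i:\mathbb X\to\mathbb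 Y_i$. KKT system (K): $0\in(\partial p(y_1);0)+\nabla f(y)+\mathcal Fx$, $\ \mathcal Gx-b=0$, $\ \mathcal F^*y+\mathcal G^*z=c$, for $(x,y,z)\in\mathbb X\times\mathbb Y\times\mathbb Z$. $\widehat\Sigma^f:\mathbb Y\to\mathbb Y$ is self-adjoint positive semidefinite with blocks $\widehat\Sigma^f_{ij}:\mathbb Y_j\to\mathbb Y_i$, such that $f(y)\le\widehat f(y,y'):=f(y')+\langle\nabla f(y'),y-y'\rangle+\tfrac12\|y-y'\|^2_{\widehat\Sigma^f}$ for all $y,y'$. For $\sigma>0$, $$\mathcal L_\sigma(y,z;(x,y')):=p(y_1)+\widehat f(y,y')-\langle b,z\rangle+\langle\mathcal F^*y+\mathcal G^*z-c,x\rangle+\tfrac\sigma2\|\mathcal F^*y+\mathcal G^*z-c\|^2 .$$ Algorithm sGS-iPADMM: $\{\tilde\varepsilon_k\}$ is a summable nonnegative sequence, $\tau\in(0,2)$, $(x^0,y^0,z^0)\in\mathbb X\times\mathbb Y\times\mathbb Z$ with $y_1^0\in\operatorname{dom}p$, $\mathcal D_i:\mathbb Y_i\to\mathbb Y_i$ self-adjoint linear. Write $y_{<i}=(y_1;\dots;y_{i-1})$, $y_{>i}=(y_{i+1};\dots;y_s)$. For $k=0,1,\dots$: Step 1. For $i=s,\dots,2$ compute $y_i^{k+1/2}\approx\operatorname{argmin}_{y_i}\{\mathcal L_\sigma((y^k_{<i};y_i;y^{k+1/2}_{>i}),z^k;(x^k,y^k))+\tfrac12\|y_i-y_i^k\|^2_{\mathcal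 D_i}\}$ such that there is $\tilde\delta_i^k$ with $\|\tilde\delta_i^k\|\le\tilde\varepsilon_k$ and $\tilde\delta_i^k\in\partial_{y_i}\mathcal L_\sigma((y^k_{<i};y_i^{k+1/2};y^{k+1/2}_{>i}),z^k;(x^k,y^k))+\mathcal D_i(y_i^{k+1/2}-y_i^k)$. Step 2. For $i=1,\dots,s$ compute $y_i^{k+1}\approx\operatorname{argmin}_{y_i}\{\mathcal L_\sigma((y^{k+1}_{<i};y_i;y^{k+1/2}_{>i}),z^k;(x^k,y^k))+\tfrac12\|y_i-y_i^k\|^2_{\mathcal D_i}\}$ such that there is $\delta_i^k$ with $\|\delta_i^k\|\le\tilde\varepsilon_k$ and $\delta_i^k\in\partial_{y_i}\mathcal L_\sigma((y^{k+1}_{<i};y_i^{k+1};y^{k+1/2}_{>i}),z^k;(x^k,y^k))+\mathcal D_i(y_i^{k+1}-y_i^k)$. Step 3. Compute $z^{k+1}\approx\operatorname{argmin}_z\mathcal L_\sigma(y^{k+1},z;(x^k,y^k))$ such that $\|\gamma^k\|\le\tilde\varepsilon_k$, where $\gamma^k:=\nabla_z\mathcal L_\sigma(y^{k+1},z^{k+1};(x^k,y^k))=\mathcal Gx^k-b+\sigma\mathcal G(\mathcal F^*y^{k+1}+\mathcal G^*z^{k+1}-c)$. Step 4. $x^{k+1}:=x^k+\tau\sigma(\mathcal F^*y^{k+1}+\mathcal G^*z^{k+1}-c)$. Set $\tilde\delta_1^k:=\delta_1^k$. Further definitions. $\mathcal N:=\widehat\Sigma^f+\sigma\mathcal F\mathcal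 F^*+\mathcal D=\mathcal N_d+\mathcal N_u+\mathcal N_u^*$, with $\mathcal N_d$ the block-diagonal part and $\mathcal N_u$ the strictly block-upper-triangular part; $\mathcal N_{\rm sGS}:=\mathcal N_u\mathcal N_d^{-1}\mathcal N_u^*$. On $\mathbb Y\times\mathbb Z$: $\mathcal T(y;z):=\big((\mathcal D+\mathcal N_{\rm sGS}+\sigma\mathcal F\mathcal G^*[\mathcal G\mathcal G^*]^\dagger\mathcal G\mathcal F^* )y;0\big)$, $\mathcal P(y;z):=(\widehat\Sigma^fy;0)$, and $\mathcal Ax:=(\mathcal Fx;\mathcal Gx)$, so $\mathcal A^*(y;z)=\mathcal F^*y+\mathcal G^*z$. $\Theta:=\tau\sigma\big(\mathcal P+\mathcal T+\tfrac{(2-\tau)\sigma}3\mathcal A\mathcal A^*\big)$ and $\Omega(x;(y;z)):=(x;\Theta(y;z))$, a self-adjoint positive semidefinite operator; $\operatorname{dist}_\Omega(u,\mathbf K):=\inf_{u'\in\mathbf K}\|u-u'\|_\Omega$. KKT residual mapping: with $w=(y;z)$, $\varphi(w):=p(y_1)$, $h(w):=f(y)-\langle b,z\rangle$, $$\mathcal R(x,w):=\big(c-\mathcal A^*w;\ w-\operatorname{Prox}_\varphi(w-\nabla h(w)-\mathcal Ax)\big),$$ whose zero set is $\mathbf K$. *)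

(* Defs.v *)
From HB Require Import structures.
From mathcomp Require Import all_boot all_order all_algebra.
From mathcomp Require Import all_classical all_reals all_analysis.

Set Implicit Arguments.
Unset Strict Implicit.
Unset Printing Implicit Defensive.

Import Order.TTheory GRing.Theory Num.Theory.
Local Open Scope classical_set_scope.
Local Open Scope ring_scope.

(* Finite-dimensional real Hilbert spaces.  The norm is derived from the inner
   product; it is deliberately not the library's canonical norm, which on a
   product is the maximum of the norms of the components. *)
HB.mixin Record Vector_isEuclid (R : realType) (V : Type) of Vector R V := {
  inner : V -> V -> R;
  innerC : forall u v, inner u v = inner v u;
  innerDl : forall u v w, inner (u + v) w = inner u w + inner v w;
  innerZl : forall (a : R) u v, inner (a *: u) v = a * inner u v;
  inner_gt0 : forall u, u != 0 -> 0 < inner u u }.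

#[short(type="euclidType")]
HB.structure Definition Euclid (R : realType) :=
  {V of Vector_isEuclid R V & Vector R V}.

Definition enorm (R : realType) (V : euclidType R) (v : V) : R :=
  Num.sqrt (inner v v).

Section PairEuclid.
Variables (R : realType) (U V : euclidType R).
Implicit Types u v w : (U * V)%type.

Definition pair_inner u v : R := inner u.1 v.1 + inner u.2 v.2.

Let pair_innerC u v : pair_inner u v = pair_inner v u.
Proof. by rewrite /pair_inner innerC [inner u.2 _]innerC. Qed.

Let pair_innerDl u v w :
  pair_inner (u + v) w = pair_inner u w + pair_inner v w.
Proof. by rewrite /pair_inner !innerDl addrACA. Qed.

Let pair_innerZl (a : R) u v : pair_inner (a *: u) v = a * pair_inner u v.
Proof. by rewrite /pair_inner !innerZl mulrDr. Qed.

Let pair_inner_gt0 u : u != 0 -> 0 < pair_inner u u.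
Proof.
case: u => u1 u2; rewrite xpair_eqE negb_and /pair_inner /=.
have ge0 (W : euclidType R) (x : W) : 0 <= inner x x.
  have [->|/inner_gt0/ltW//] := eqVneq x 0.
  by rewrite -(scale0r (0 : W)) innerZl mul0r.
by case/orP => /inner_gt0 h; [apply: ltr_wpDr | apply: ltr_wpDl].
Qed.

HB.instance Definition _ := Vector_isEuclid.Build R (U * V)%type
  pair_innerC pair_innerDl pair_innerZl pair_inner_gt0.
End PairEuclid.

(* The product of a finite family of Hilbert spaces. *)
Section BlockModule.
Variables (R : nzRingType) (n : nat) (Y : 'I_n -> lmodType R).
Local Notation prodY := {dffun forall i, Y i}.

Definition bzero : prodY := [ffun i => 0].
Definition bopp (y : prodY) : prodY := [ffun i => - y i].
Definition badd (y y' : prodY) : prodY := [ffun i => y i + y' i].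
Definition bscale (a : R) (y : prodY) : prodY := [ffun i => a *: y i].

Let baddA : associative badd.
Proof. by move=> *; apply/ffunP => i; rewrite !ffunE addrA. Qed.
Let baddC : commutative badd.
Proof. by move=> *; apply/ffunP => i; rewrite !ffunE addrC. Qed.
Let badd0 : left_id bzero badd.
Proof. by move=> *; apply/ffunP => i; rewrite !ffunE add0r. Qed.
Let baddN : left_inverse bzero bopp badd.
Proof. by move=> *; apply/ffunP => i; rewrite !ffunE addNr. Qed.

HB.instance Definition _ := GRing.isZmodule.Build prodY baddA baddC badd0 baddN.

Let bscaleA a b y : bscale a (bscale b y) = bscale (a * b) y.
Proof. by apply/ffunP => i; rewrite !ffunE scalerA. Qed.
Let bscale1 : left_id 1 bscale.
Proof. by move=> *; apply/ffunP => i; rewrite !ffunE scale1r. Qed.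
Let bscaleDr : right_distributive bscale +%R.
Proof. by move=> *; apply/ffunP => i; rewrite !ffunE scalerDr. Qed.
Let bscaleDl y : {morph bscale^~ y : a b / a + b}.
Proof. by move=> *; apply/ffunP => i; rewrite !ffunE scalerDl. Qed.

HB.instance Definition _ :=
  GRing.Zmodule_isLmodule.Build R prodY bscaleA bscale1 bscaleDr bscaleDl.
End BlockModule.

Section BlockVector.
Import VectorInternalTheory.
Variables (R : nzRingType) (n : nat) (Y : 'I_n -> vectType R).
Local Notation prodY := {dffun forall i, Y i}.

Fact bvect_iso : Vector.axiom (\sum_(i < n) dim (Y i)) prodY.
Proof.
pose to (y : prodY) := \mxrow_(i < n) (v2r (y i)).
exists to.
  move=> a y z; apply/mxrowP => i; rewrite mxrowK.
  rewrite (_ : (a *: y + z) i = a *: y i + z i); last by rewrite !ffunE.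
  have toE w : submxrow (to w) i = v2r (w i) by rewrite mxrowK.
  have -> : v2r (a *: y i + z i) = a *: v2r (y i) + v2r (z i) by exact: linearP.
  by rewrite -!toE; apply/rowP => j; rewrite !mxE.
exists (fun r => [ffun i => r2v (submxrow r i)] : prodY) => [y|r].
  by apply/ffunP => i; rewrite ffunE mxrowK v2rK.
by apply/mxrowP => i; rewrite mxrowK ffunE r2vK.
Qed.

HB.instance Definition _ := Lmodule_hasFinDim.Build R prodY bvect_iso.
End BlockVector.

Section BlockEuclid.
Variables (R : realType) (n : nat) (Y : 'I_n -> euclidType R).
Local Notation prodY := {dffun forall i, Y i}.
Implicit Types y : prodY.

Definition block_inner y y' : R := \sum_i inner (y i) (y' i).

Let block_innerC y y' : block_inner y y' = block_inner y' y.
Proof. by apply: eq_bigr => i _; rewrite innerC. Qed.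

Let block_innerDl y1 y2 y :
  block_inner (y1 + y2) y = block_inner y1 y + block_inner y2 y.
Proof.
by rewrite -big_split; apply: eq_bigr => i _; rewrite ffunE innerDl.
Qed.

Let block_innerZl (a : R) y y' :
  block_inner (a *: y) y' = a * block_inner y y'.
Proof. by rewrite mulr_sumr; apply: eq_bigr => i _; rewrite ffunE innerZl. Qed.

Let block_inner_gt0 y : y != 0 -> 0 < block_inner y y.
Proof.
move=> y0; have ge0 i : 0 <= inner (y i) (y i).
  have [->|/inner_gt0/ltW//] := eqVneq (y i) 0.
  by rewrite -(scale0r (0 : Y i)) innerZl mul0r.
rewrite lt_def sumr_ge0 ?andbT //; apply: contra_neq y0.
move=> /psumr_eq0P h; apply/ffunP => i; rewrite ffunE; apply/eqP.
apply: contraT => /inner_gt0; rewrite h ?ltxx // => j _; exact: ge0.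
Qed.

HB.instance Definition _ := Vector_isEuclid.Build R prodY
  block_innerC block_innerDl block_innerZl block_inner_gt0.

Definition bproj_fun i (y : prodY) : Y i := y i.
Definition binj_fun i (v : Y i) : prodY := 
  [ffun k => eqtype.dfwith (fun j => 0 : Y j) v k].

Fact bproj_linear i : linear (@bproj_fun i).
Proof. by move=> a y y'; rewrite /bproj_fun !ffunE. Qed.
HB.instance Definition _ i :=
  GRing.isLinear.Build R prodY (Y i) _ (@bproj_fun i) (@bproj_linear i).

Fact binj_linear i : linear (@binj_fun i).
Proof.
move=> a v v'; apply/ffunP => j; rewrite !ffunE.
have [<-|ij] := eqVneq i j; first by rewrite !eqtype.dfwith_in.
by rewrite !eqtype.dfwith_out // scaler0 addr0.
Qed.
HB.instance Definition _ i :=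
  GRing.isLinear.Build R (Y i) prodY _ (@binj_fun i) (@binj_linear i).

Definition bproj i : 'Hom(prodY, Y i) := linfun (@bproj_fun i).
Definition binj i : 'Hom(Y i, prodY) := linfun (@binj_fun i).

Lemma bprojE i y : bproj i y = y i.
Proof. by rewrite lfunE. Qed.

Lemma binjE i (v : Y i) j : binj i v j = eqtype.dfwith (fun j => 0 : Y j) v j.
Proof. by rewrite lfunE /= ffunE. Qed.

Definition block (A : 'End(prodY)) i j : 'Hom(Y j, Y i) :=
  (bproj i \o A \o binj j)%VF.
Definition bdiag (B : forall i, 'End(Y i)) : 'End(prodY) :=
  \sum_i (binj i \o B i \o bproj i)%VF.
Definition diag_part (A : 'End(prodY)) : 'End(prodY) :=
  bdiag (fun i => block A i i).
Definition upper_part (A : 'End(prodY)) : 'End(prodY) :=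
  \sum_(i < n) \sum_(j < n | (i < j)%N) (binj i \o block A i j \o bproj j)%VF.

(* (lo_{<i}; v; hi_{>i}) *)
Definition bmix i (lo : prodY) (v : Y i) (hi : prodY) : prodY :=
  [ffun k => eqtype.dfwith (fun j : 'I_n => if (j < i)%N then lo j else hi j) v k].
End BlockEuclid.

Section Operators.
Variables (R : realType) (U V : euclidType R).

Definition adj (A : 'Hom(U, V)) : 'Hom(V, U) :=
  xget 0 [set B : 'Hom(V, U) | forall u v, inner (A u) v = inner u (B v)].

Lemma adjP (A : 'Hom(U, V)) u v : inner (A u) v = inner u (adj A v).
Proof.
have DlU (x y w : U) : inner w (x + y) = inner w x + inner w y.
  by rewrite innerC innerDl !(innerC w).
have ZrU (a : R) (x w : U) : inner w (a *: x) = a * inner w x.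
  by rewrite innerC innerZl (innerC w).
have lin1 (w : U) : linear (fun x : U => inner x w : R^o).
  by move=> a x y; rewrite innerDl innerZl.
pose ell (w : U) : {linear U -> R^o} :=
  HB.pack (fun x : U => inner x w : R^o) (GRing.isLinear.Build _ _ _ _ _ (lin1 w)).
have lin2 : linear (fun w : U => linfun (ell w)).
  move=> a x y; apply/lfunP => w.
  by rewrite !lfun_simp /= DlU ZrU.
pose L_ : {linear U -> 'Hom(U, R^o)} :=
  HB.pack (fun w : U => linfun (ell w)) (GRing.isLinear.Build _ _ _ _ _ lin2).
pose L := linfun L_.
have LE w x : L w x = inner x w by rewrite !lfunE /=.
have kerL : lker L == 0%VS.
  apply/lker0P => x y /(congr1 (fun h : 'Hom(U, R^o) => h (x - y))).
  rewrite !LE => /eqP; rewrite -subr_eq0 => /eqP e.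
  apply/eqP; rewrite -subr_eq0; apply: contraT => /inner_gt0.
  have -> : inner (x - y) (x - y) = inner (x - y) x - inner (x - y) y.
    by rewrite DlU -scaleN1r ZrU mulN1r.
  by rewrite e ltxx.
have imL : limg L = fullv.
  apply/eqP; rewrite eqEdim subvf /= limg_dim_eq; last first.
    by move: kerL => /eqP ->; rewrite capv0.
  by rewrite !dimvf /dim /= muln1.
have lin3 (y : V) : linear (fun x : U => inner (A x) y : R^o).
  by move=> a x x'; rewrite linearP innerDl innerZl.
pose m (y : V) : {linear U -> R^o} :=
  HB.pack (fun x : U => inner (A x) y : R^o)
    (GRing.isLinear.Build _ _ _ _ _ (lin3 y)).
have lin4 : linear (fun y : V => linfun (m y)).
  move=> a y y'; apply/lfunP => x.
  by rewrite !lfun_simp /= innerC innerDl innerZl !(innerC _ (A x)).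
pose M_ : {linear V -> 'Hom(U, R^o)} :=
  HB.pack (fun y : V => linfun (m y)) (GRing.isLinear.Build _ _ _ _ _ lin4).
pose B := (L^-1 \o linfun M_)%VF.
suff hB : forall x y, inner (A x) y = inner x (B y).
  by rewrite /adj; case: xgetP => [B' -> //|/(_ B)].
move=> x y; rewrite -LE comp_lfunE limg_lfunVK ?imL ?memvf //.
by rewrite !lfunE.
Qed.

(* The Penrose equations, which have exactly one solution. *)
Definition is_moore_penrose (A : 'Hom(U, V)) (B : 'Hom(V, U)) : Prop :=
  [/\ (A \o B \o A)%VF = A, (B \o A \o B)%VF = B,
      forall v v', inner ((A \o B)%VF v) v' = inner v ((A \o B)%VF v') &
      forall u u', inner ((B \o A)%VF u) u' = inner u ((B \o A)%VF u')].
Definition moore_penrose (A : 'Hom(U, V)) : 'Hom(V, U) :=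
  xget 0 [set B | is_moore_penrose A B].
End Operators.

Section OneSpace.
Variables (R : realType) (V : euclidType R).

Definition self_adjoint (A : 'End(V)) : Prop := adj A = A.
Definition psd (A : 'End(V)) : Prop := forall v, 0 <= inner v (A v).
Definition pd (A : 'End(V)) : Prop := forall v, v != 0 -> 0 < inner v (A v).

Definition onorm (A : V -> V) (v : V) : R := Num.sqrt (inner v (A v)).
Definition odist (A : V -> V) (v : V) (K : set V) : R :=
  inf [set onorm A (v - v') | v' in K].
Definition edist (v : V) (K : set V) : R := inf [set enorm (v - v') | v' in K].

Definition metric_proj (H : set V) (v : V) : V :=
  xget 0 [set w | H w /\ forall w', H w' -> enorm (v - w) <= enorm (v - w')].

Definition is_gradient (f : V -> R) (v g : V) : Prop :=
  forall e : R, 0 < e -> exists2 d : R, 0 < d & forall h : V, enorm h < d ->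
    `|f (v + h) - f v - inner g h| <= e * enorm h.
Definition grad (f : V -> R) (v : V) : V := xget 0 [set g | is_gradient f v g].

Definition differentiable_with_lipschitz_grad (f : V -> R) : Prop :=
  (forall v, exists g, is_gradient f v g) /\
  (exists L : R, forall v v', enorm (grad f v - grad f v') <= L * enorm (v - v')).

Definition convex_real (f : V -> R) : Prop :=
  forall (t : R) v v', 0 <= t <= 1 ->
    f (t *: v + (1 - t) *: v') <= t * f v + (1 - t) * f v'.

Local Open Scope ereal_scope.

Definition proper (th : V -> \bar R) : Prop :=
  (forall v, th v != -oo) /\ (exists v, th v != +oo).
Definition convex_ereal (th : V -> \bar R) : Prop :=
  forall (t : R) v v', (0 < t < 1)%R ->
    th (t *: v + (1 - t) *: v')%R <= t%:E * th v + (1 - t)%:E * th v'.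
(* lower semicontinuity, i.e. closedness of the epigraph *)
Definition closed_ereal (th : V -> \bar R) : Prop :=
  forall v (a : R), a%:E < th v ->
    exists2 d : R, (0 < d)%R & forall v', (enorm (v' - v) < d)%R -> a%:E < th v'.
Definition closed_proper_convex (th : V -> \bar R) : Prop :=
  [/\ closed_ereal th, proper th & convex_ereal th].

Definition subdiff (th : V -> \bar R) (v : V) : set V :=
  [set g | th v \is a fin_num /\
           forall v', th v + (inner g (v' - v))%:E <= th v'].

Definition argmin (th : V -> \bar R) : set V :=
  [set v | forall v', th v <= th v'].
Definition prox (th : V -> \bar R) (v : V) : V :=
  xget 0%R (argmin (fun v' => th v' + (2^-1 * enorm (v - v') ^+ 2)%:E)).
End OneSpace.

Section Problem.
Variables (R : realType) (X Z : euclidType R).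
Variables (s : nat) (Y : 'I_s.+1 -> euclidType R).
Local Notation prodY := {dffun forall i, Y i}.
Variables (p : Y ord0 -> \bar R) (f : prodY -> R) (Sigma : 'End(prodY)).
Variables (F : 'Hom(X, prodY)) (G : 'Hom(X, Z)) (b : Z) (c : X).

Definition opA (x : X) : prodY * Z := (F x, G x).
Definition opAadj (w : prodY * Z) : X := adj F w.1 + adj G w.2.

Definition KKT : set (X * (prodY * Z)) :=
  [set u : X * (prodY * Z) | let: (x, (y, z)) := u in
    [/\ exists2 g, subdiff p (y ord0) g & binj Y ord0 g + grad f y + F x = 0,
        G x - b = 0 &
        adj F y + adj G z = c]].

Definition fhat (y y' : prodY) : R :=
  f y' + inner (grad f y') (y - y') + 2^-1 * inner (y - y') (Sigma (y - y')).

Definition majorized : Prop := forall y y', f y <= fhat y y'.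

Definition auglag (sigma : R) (y : prodY) (z : Z) (x : X) (y' : prodY) :
    \bar R :=
  (p (y ord0) + (fhat y y' - inner b z + inner (adj F y + adj G z - c) x
                 + sigma / 2 * enorm (adj F y + adj G z - c) ^+ 2)%:E)%E.

Definition kkt_residual (u : X * (prodY * Z)) : X * (prodY * Z) :=
  let: (x, w) := u in
  let phi (w : prodY * Z) := p (w.1 ord0) in
  let h (w : prodY * Z) := f w.1 - inner b w.2 in
  (c - opAadj w, w - prox phi (w - grad h w - opA x)).

Section Algorithm.
Variables (sigma tau : R) (D : forall i, 'End(Y i)).

Definition gamma (x : nat -> X) (y : nat -> prodY) (z : nat -> Z) (k : nat) : Z :=
  G (x k) - b + sigma *: G (adj F (y k.+1) + adj G (z k.+1) - c).

(* [yh k] is y^{k+1/2} (its block 0 is not used), [dt] and [d] are the error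
   vectors of the backward and of the forward sweep.  Blocks are numbered from
   0, so that y_1 is [y ord0]. *)
Record sGS_iPADMM (eps : nat -> R) (x : nat -> X) (y yh : nat -> prodY)
    (z : nat -> Z) (dt d : nat -> prodY) : Prop := {
  sGS_init : (p (y 0%N ord0) < +oo)%E;
  sGS_backward : forall k (i : 'I_s.+1), i != ord0 ->
    enorm (dt k i) <= eps k /\
    [set g + D i (yh k i - y k i) | g in
      subdiff (fun v : Y i => auglag sigma (bmix (y k) v (yh k)) (z k) (x k) (y k))
              (yh k i)] (dt k i);
  sGS_forward : forall k (i : 'I_s.+1),
    enorm (d k i) <= eps k /\
    [set g + D i (y k.+1 i - y k i) | g in
      subdiff (fun v : Y i =>
                 auglag sigma (bmix (y k.+1) v (yh k)) (z k) (x k) (y k))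
              (y k.+1 i)] (d k i);
  sGS_dt0 : forall k, dt k ord0 = d k ord0;
  sGS_z : forall k, enorm (gamma x y z k) <= eps k;
  sGS_x : forall k,
    x k.+1 = x k + (tau * sigma) *: (adj F (y k.+1) + adj G (z k.+1) - c) }.

Definition opN : 'End(prodY) := Sigma + sigma *: (F \o adj F)%VF + bdiag D.

(* On an injective endomorphism the library's [_^-1] is the inverse. *)
Definition opNsGS : 'End(prodY) :=
  (upper_part opN \o (diag_part opN)^-1 \o adj (upper_part opN))%VF.

Definition opT (w : prodY * Z) : prodY * Z :=
  ((bdiag D + opNsGS
    + sigma *: (F \o adj G \o moore_penrose (G \o adj G) \o G \o adj F)%VF) w.1, 0).
Definition opP (w : prodY * Z) : prodY * Z := (Sigma w.1, 0).
Definition opTheta (w : prodY * Z) : prodY * Z :=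
  (tau * sigma) *:
    (opP w + opT w + ((2 - tau) * sigma / 3) *: opA (opAadj w)).
Definition opOmega (u : X * (prodY * Z)) : X * (prodY * Z) :=
  (u.1, opTheta u.2).
End Algorithm.

Definition metric_subregular_at (u0 : X * (prodY * Z)) (kappa : R) : Prop :=
  exists2 r : R, 0 < r & forall u, enorm (u - u0) <= r ->
    edist u KKT <= kappa * enorm (kkt_residual u).
End Problem.

(* Main.v *)
Require Import Defs.
From HB Require Import structures.
From mathcomp Require Import all_boot all_order all_algebra.
From mathcomp Require Import all_classical all_reals all_analysis.
From mathcomp Require Import ring lra.

Set Implicit Arguments.
Unset Strict Implicit.
Unset Printing Implicit Defensive.

Import Order.TTheory GRing.Theory Num.Theory.
Import numFieldNormedType.Exports.
Local Open Scope classical_set_scope.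
Local Open Scope ring_scope.

(** The algorithm is a proximal augmented Lagrangian method in disguise.  The
    backward and the forward sweep over the blocks of [y] amount to one inexact
    proximal step in all blocks at once, with the additional metric [opNsGS]
    ([sGS_decomposition], [sGS_optimality]).  When [gamma] vanishes and
    [G (x 0) = b], every residual [e k := adj F (y k) + adj G (z k) - c], for
    positive [k], lies in the kernel of [G]; the change of [z] is then determined by
    that of [y], and using [z k] instead of [z k.+1] in the sweeps only adds to the
    metric the term with the projection on the range of [adj G]
    ([proximal_optimality]).

    Monotonicity of the subdifferential of [p], the inequality
    [majorized_gradient] for the gradient of [f] and the multiplier update give
    [one_step_inequality]: in the seminorm of [Omega] the distance to any solution
    decreases, up to the sweep error, by a quadratic form of the step.  That form
    dominates the squared length of the step from [v k] to [v k.+1]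
    ([opB_coercive], [sufficient_decrease]), because it is positive definite
    modulo the part of [z] that [adj G] does not see ([opQ_pd]).  The seminorm does
    not see this part either, which is the equality of the distances of [u k] and
    [v k] ([odist_range_proj]).

    Conversely, the optimality conditions of the step bound the KKT residual at
    [v k.+1] by the length of the step ([residual_bounded]).  By metric
    subregularity the same bound, up to a constant, holds for the distance from
    [v k.+1], hence from [u k], to the solution set.  So each step decreases the
    squared distance by a fixed fraction of itself, while the sweep errors are
    negligible with respect to the length of the step ([contraction_step]). *)

(** * Inner products, norms and adjoints *)

Section InnerTheory.
Variables (R : realType) (V : euclidType R).
Implicit Types u v w : V.

Lemma innerDr u v w : inner w (u + v) = inner w u + inner w v.
Proof. by rewrite innerC innerDl !(innerC w). Qed.
Lemma innerZr (a : R) u v : inner u (a *: v) = a * inner u v.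
Proof. by rewrite innerC innerZl innerC. Qed.
Lemma inner0l v : inner 0 v = 0.
Proof. by rewrite -(scale0r (0 : V)) innerZl mul0r. Qed.
Lemma inner0r v : inner v 0 = 0.
Proof. by rewrite innerC inner0l. Qed.
Lemma innerNl u v : inner (- u) v = - inner u v.
Proof. by rewrite -scaleN1r innerZl mulN1r. Qed.
Lemma innerNr u v : inner u (- v) = - inner u v.
Proof. by rewrite innerC innerNl innerC. Qed.

Definition innerE :=
  (@innerDl R V, innerDr, innerNl, innerNr, @innerZl R V, innerZr).

Lemma inner_ge0 u : 0 <= inner u u.
Proof. by have [->|/inner_gt0/ltW//] := eqVneq u 0; rewrite inner0l. Qed.
Lemma inner_eq0 u : inner u u = 0 -> u = 0.
Proof. by move=> h; apply: contra_eq h => /inner_gt0; rewrite lt0r => /andP[]. Qed.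
Lemma inner_sumr I (r : seq I) (P : pred I) (G : I -> V) w :
  inner w (\sum_(i <- r | P i) G i) = \sum_(i <- r | P i) inner w (G i).
Proof.
elim/big_rec2: _ => [|i y1 y2 _ <-]; first by rewrite inner0r.
by rewrite innerDr.
Qed.

Lemma eq_inner u v : (forall w, inner u w = inner v w) -> u = v.
Proof.
move=> h; apply/eqP; rewrite -subr_eq0; apply/eqP/inner_eq0.
by rewrite innerDl innerNl h subrr.
Qed.

Lemma enorm_ge0 u : 0 <= enorm u. Proof. exact: sqrtr_ge0. Qed.
Lemma enorm_sqr u : enorm u ^+ 2 = inner u u.
Proof. by rewrite sqr_sqrtr ?inner_ge0. Qed.
Lemma enorm0 : enorm (0 : V) = 0.
Proof. by rewrite /enorm inner0l sqrtr0. Qed.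
Lemma enorm_eq0 u : enorm u = 0 -> u = 0.
Proof. by move=> h; apply: inner_eq0; rewrite -enorm_sqr h expr0n. Qed.
Lemma enormZ (a : R) u : enorm (a *: u) = `|a| * enorm u.
Proof.
by rewrite /enorm innerZl innerZr mulrA -expr2 sqrtrM ?sqr_ge0// sqrtr_sqr.
Qed.
Lemma enormN u : enorm (- u) = enorm u.
Proof. by rewrite -scaleN1r enormZ normrN1 mul1r. Qed.
Lemma enormBC u v : enorm (u - v) = enorm (v - u).
Proof. by rewrite -enormN opprB. Qed.

Lemma cauchy_schwarz u v : inner u v <= enorm u * enorm v.
Proof.
have [->|v0] := eqVneq v 0; first by rewrite inner0r enorm0 mulr0.
have [->|u0] := eqVneq u 0; first by rewrite inner0l enorm0 mul0r.
have nu : 0 < enorm u by rewrite sqrtr_gt0 inner_gt0.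
have nv : 0 < enorm v by rewrite sqrtr_gt0 inner_gt0.
have := inner_ge0 (enorm v *: u - enorm u *: v).
rewrite !innerE -!enorm_sqr (innerC v u) => h.
have {}h : 0 <= (enorm u * enorm v) * (enorm u * enorm v - inner u v) by nra.
by rewrite -subr_ge0 -(pmulr_rge0 _ (mulr_gt0 nu nv)).
Qed.

Lemma cauchy_schwarz_abs u v : `|inner u v| <= enorm u * enorm v.
Proof.
by rewrite ler_norml cauchy_schwarz lerNl -innerNl -(enormN u) cauchy_schwarz.
Qed.

Lemma enormD u v : enorm (u + v) <= enorm u + enorm v.
Proof.
rewrite -(ler_pXn2r (_ : 0 < 2)%N) ?nnegrE ?addr_ge0 ?enorm_ge0//.
rewrite sqrrD !enorm_sqr !innerE (innerC v u).
have := cauchy_schwarz u v; lra.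
Qed.
Lemma enormB u v : enorm (u - v) <= enorm u + enorm v.
Proof. by rewrite -(enormN v) enormD. Qed.

Lemma enorm_le_sqr u (a : R) : 0 <= a -> inner u u <= a ^+ 2 -> enorm u <= a.
Proof.
move=> a0 h; rewrite -(ler_pXn2r (_ : 0 < 2)%N) ?nnegrE ?enorm_ge0//.
by rewrite enorm_sqr.
Qed.
End InnerTheory.

Lemma inner_le_sqr (R : realType) (U V : euclidType R) (u : U) (v : V) (C : R) :
  0 <= C -> enorm u <= C * enorm v -> inner u u <= C ^+ 2 * inner v v.
Proof.
move=> C0 h; rewrite -!enorm_sqr -exprMn ler_sqr ?nnegrE ?enorm_ge0//.
by rewrite mulr_ge0 ?enorm_ge0.
Qed.

(** Vectors are equal as soon as their inner products with every vector are, and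
    for two linear combinations these are polynomial identities. *)
Ltac vring := apply: eq_inner => ?;
  rewrite ?(innerDl, innerNl, innerZl, inner0l); ring.

Section PairInner.
Variables (R : realType) (U V : euclidType R).
Implicit Types u : (U * V)%type.

Lemma inner_pairE u u' : inner u u' = inner u.1 u'.1 + inner u.2 u'.2.
Proof. by []. Qed.
Lemma enorm_fst u : enorm u.1 <= enorm u.
Proof.
by apply: enorm_le_sqr (enorm_ge0 _) _; rewrite enorm_sqr inner_pairE lerDl inner_ge0.
Qed.
Lemma enorm_snd u : enorm u.2 <= enorm u.
Proof.
by apply: enorm_le_sqr (enorm_ge0 _) _; rewrite enorm_sqr inner_pairE lerDr inner_ge0.
Qed.
Lemma enorm_pair u : enorm u <= enorm u.1 + enorm u.2.
Proof.
apply: enorm_le_sqr; first by rewrite addr_ge0 ?enorm_ge0.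
rewrite sqrrD !enorm_sqr inner_pairE.
by have := mulr_ge0 (enorm_ge0 u.1) (enorm_ge0 u.2); lra.
Qed.
End PairInner.

Lemma enorm_sqr_triple (R : realType) (U1 U2 U3 : euclidType R)
    (w : U1 * (U2 * U3)) :
  enorm w ^+ 2 = inner w.1 w.1 + (inner w.2.1 w.2.1 + inner w.2.2 w.2.2).
Proof. by rewrite enorm_sqr. Qed.

(** Scalars as a Hilbert space, so that [adj] represents linear functionals. *)
Section ScalarEuclid.
Variable R : realType.
Let sinner (a b : R^o) : R := a * b.
Let sinnerC a b : sinner a b = sinner b a. Proof. exact: mulrC. Qed.
Let sinnerDl a b c : sinner (a + b) c = sinner a c + sinner b c.
Proof. exact: mulrDl. Qed.
Let sinnerZl (t : R) a b : sinner (t *: a) b = t * sinner a b.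
Proof. by rewrite /sinner -mulrA. Qed.
Let sinner_gt0 a : a != 0 -> 0 < sinner a a.
Proof. by move=> a0; rewrite /sinner -expr2 exprn_even_gt0. Qed.
HB.instance Definition _ :=
  Vector_isEuclid.Build R R^o sinnerC sinnerDl sinnerZl sinner_gt0.
End ScalarEuclid.

Section HomTheory.
Variables (R : realType) (U V : euclidType R).
Implicit Types (A B : 'Hom(U, V)).

Lemma adjPr A u v : inner (adj A v) u = inner v (A u).
Proof. by rewrite innerC -adjP innerC. Qed.

Lemma adj_unique A (B : 'Hom(V, U)) :
  (forall u v, inner (A u) v = inner u (B v)) -> adj A = B.
Proof.
move=> h; apply/lfunP => v; apply: eq_inner => u.
by rewrite innerC -adjP h innerC.
Qed.

End HomTheory.

Lemma adjK (R : realType) (U V : euclidType R) (A : 'Hom(U, V)) :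
  adj (adj A) = A.
Proof. by apply: adj_unique => v u; rewrite adjPr. Qed.

(** Every linear functional is an inner product, so the Cauchy-Schwarz inequality
    bounds the coordinates in a basis. *)
Lemma coord_bounded (R : realType) (U : euclidType R) : exists2 C : R, 0 <= C &
  forall (i : 'I_(\dim {:U})) (u : U), `|coord (vbasis {:U}) i u| <= C * enorm u.
Proof.
pose a i := adj (linfun (coord (vbasis {:U}) i : U -> R^o)) 1.
exists (\sum_i enorm (a i)) => [|i u].
  by apply: sumr_ge0 => i _; exact: enorm_ge0.
have -> : coord (vbasis {:U}) i u = inner u (a i).
  by rewrite /a -adjP lfunE /= /inner /= mulr1.
apply: le_trans (cauchy_schwarz_abs _ _) _; rewrite mulrC.
apply: ler_wpM2r; first exact: enorm_ge0.
by rewrite (bigD1 i) //= lerDl; apply: sumr_ge0 => j _; exact: enorm_ge0.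
Qed.

Section HomBounded.
Variables (R : realType) (U V : euclidType R).

Lemma enorm_sum I (r : seq I) (P : pred I) (G : I -> V) :
  enorm (\sum_(i <- r | P i) G i) <= \sum_(i <- r | P i) enorm (G i).
Proof.
elim/big_rec2: _ => [|i y1 y2 _ h]; first by rewrite enorm0.
by apply: le_trans (enormD _ _) _; rewrite lerD2l.
Qed.

Lemma hom_bounded (A : 'Hom(U, V)) :
  exists2 C : R, 0 < C & forall u, enorm (A u) <= C * enorm u.
Proof.
have [C C0 hC] := @coord_bounded R U.
pose e := vbasis {:U}.
exists (\sum_(i < \dim {:U}) (C * enorm (A e`_i)) + 1).
  by apply: ltr_wpDl => //; apply: sumr_ge0 => i _; rewrite mulr_ge0 ?enorm_ge0.
move=> u; rewrite {1}(coord_vbasis (memvf u)) linear_sum.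
apply: le_trans (enorm_sum _ _ _) _.
rewrite mulrDl mulr_suml -[leLHS]addr0 lerD ?mul1r ?enorm_ge0//.
apply: ler_sum => i _; rewrite linearZ enormZ mulrAC.
by apply: ler_wpM2r; [exact: enorm_ge0 | exact: hC].
Qed.

End HomBounded.

Lemma form_bounded (R : realType) (U : euclidType R) (A : 'End(U)) :
  exists2 C : R, 0 < C & forall u, inner u (A u) <= C * inner u u.
Proof.
have [C C0 hC] := hom_bounded A.
exists C => // u; apply: le_trans (cauchy_schwarz _ _) _.
rewrite -enorm_sqr expr2 mulrCA; apply: ler_wpM2l => //; exact: enorm_ge0.
Qed.

(** * Self-adjoint operators, pseudoinverses and projections *)

Section SelfAdjoint.
Variables (R : realType) (V : euclidType R).
Implicit Types (A B C P T : 'End(V)).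

Lemma self_adjointP A :
  self_adjoint A <-> forall u v, inner (A u) v = inner u (A v).
Proof. by split=> [h u v|]; [rewrite adjP h | exact: adj_unique]. Qed.

Lemma self_adjointD A B : self_adjoint A -> self_adjoint B -> self_adjoint (A + B).
Proof.
move=> /self_adjointP sA /self_adjointP sB; apply/self_adjointP => u v.
by rewrite !add_lfunE innerDl innerDr sA sB.
Qed.
Lemma self_adjointZ (a : R) A : self_adjoint A -> self_adjoint (a *: A).
Proof.
move=> /self_adjointP sA; apply/self_adjointP => u v.
by rewrite !scale_lfunE innerZl innerZr sA.
Qed.

(** The range and the kernel of a self-adjoint operator are orthogonal, hence
    complementary because their dimensions add up. *)
Lemma orthogonal_projection_ker C : self_adjoint C ->
  exists P, [/\ self_adjoint P, forall v, C (P v) = 0,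
                forall v, C v = 0 -> P v = v & forall v, P (C v) = 0].
Proof.
move=> /self_adjointP sC.
have dis : (lker C :&: limg C = 0)%VS.
  apply/eqP; rewrite -subv0; apply/subvP => v; rewrite memv_cap => /andP[].
  rewrite memv_ker => /eqP Cv /memv_imgP[u _ vE]; rewrite memv0.
  by apply/eqP/inner_eq0; rewrite {1}vE sC Cv inner0r.
have dis' : (limg C :&: lker C = 0)%VS by rewrite capvC.
have full : (lker C + limg C)%VS = fullv.
  apply/eqP; rewrite eqEdim subvf /= dimv_disjoint_sum//.
  by rewrite -(limg_ker_dim C fullv) capfv.
pose P := daddv_pi (lker C) (limg C).
have CP v : C (P v) = 0 by apply/eqP; rewrite -memv_ker memv_pi.
have dec v : exists t, v = P v + C t.
  have := daddv_pi_add dis (_ : v \in (lker C + limg C)%VS).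
  rewrite full memvf => /(_ isT).
  have /memv_imgP[t _ ->] := memv_pi (limg C) (lker C) v.
  by move=> e; exists t; rewrite e.
have PP u v : inner (P u) v = inner (P u) (P v).
  have [t {1}->] := dec v.
  by rewrite innerDr -sC CP inner0l addr0.
exists P; split=> //.
- by apply/self_adjointP => u v; rewrite PP [RHS]innerC [RHS]PP innerC.
- move=> v Cv; rewrite /P daddv_pi_id// memv_ker; exact/eqP.
- by move=> v; apply: inner_eq0; rewrite -PP innerC sC CP inner0r.
Qed.

Lemma injective_lker A : (forall v, A v = 0 -> v = 0) -> lker A == 0%VS.
Proof.
move=> h; rewrite -subv0; apply/subvP => v.
by rewrite memv_ker memv0 => /eqP /h ->.
Qed.

(** Let [P] be the orthogonal projection on the kernel of [C].  Then [C + P] is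
    invertible, and its inverse minus [P] inverts [C] on the range of [C] and
    vanishes on the kernel. *)
Lemma moore_penrose_exists C : self_adjoint C -> exists B, is_moore_penrose C B.
Proof.
move=> saC; have [P [saP CP PC PCv]] := orthogonal_projection_ker saC.
have /self_adjointP sC := saC; have /self_adjointP sP := saP.
pose T := C + P.
have TE v : T v = C v + P v by rewrite /T lfun_simp.
have kT : lker T == 0%VS.
  apply: injective_lker => v; rewrite TE => /eqP; rewrite addr_eq0 => /eqP Cv.
  have PPv : P (P v) = P v by rewrite PC.
  have : P (C v) = 0 by [].
  rewrite Cv linearN /= PPv => /eqP; rewrite oppr_eq0 => /eqP Pv.
  by rewrite -[v]PC // Cv Pv oppr0.
pose S := (T^-1)%VF.
have ST v : S (T v) = v by rewrite /S lker0_lfunK.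
have TS v : T (S v) = v by rewrite /S lker0_lfunVK.
have TP v : T (P v) = P v by rewrite TE CP add0r PC.
have SP v : S (P v) = P v by rewrite -{1}TP ST.
have SC v : S (C v) = v - P v.
  by rewrite -[RHS]ST linearB /= TP TE addrK.
have PI v : P (P v) = P v by rewrite PC.
have PS v : P (S v) = P v.
  by rewrite -{2}[v]TS TE linearD /= PCv add0r PI.
have CS v : C (S v) = v - P v.
  by apply/eqP; rewrite eq_sym subr_eq -{1}(TS v) TE PS.
pose B := S - P.
have BE v : B v = S v - P v by rewrite /B !lfun_simp.
have CB v : C (B v) = v - P v by rewrite BE linearB /= CP subr0 CS.
have BC v : B (C v) = v - P v by rewrite BE PCv subr0 SC.
have BP v : B (P v) = 0 by rewrite BE SP PI subrr.
exists B; split.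
- by apply/lfunP => v; rewrite !comp_lfunE BC linearB /= CP subr0.
- by apply/lfunP => v; rewrite !comp_lfunE CB linearB /= BP subr0.
- by move=> v v'; rewrite !comp_lfunE !CB !innerE sP.
- by move=> v v'; rewrite !comp_lfunE !BC !innerE sP.
Qed.

Lemma moore_penroseP C : self_adjoint C -> is_moore_penrose C (moore_penrose C).
Proof.
move=> /moore_penrose_exists[B hB]; rewrite /moore_penrose.
by case: xgetP => [B' -> //|/(_ B)].
Qed.

(** The form is nonnegative at [v - C^-1 *: A v], where [C] bounds the form. *)
Lemma psd_form_bounds_image A : self_adjoint A -> psd A ->
  exists2 C : R, 0 < C & forall v, inner (A v) (A v) <= C * inner v (A v).
Proof.
move=> /self_adjointP sA pA; have [C C0 hC] := form_bounded A.
exists C => // v; have := pA (v - C^-1 *: A v); have := hC (A v).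
rewrite linearB /= [A (_ *: _)]linearZ /= !innerE -(sA v (A v)).
move: (inner (A v) (A v)) (inner (A v) (A (A v))) (inner v _) => a q t hq h.
have C2 : 0 < C * C by rewrite mulr_gt0.
rewrite -(ler_pM2l C0); suff : 0 <= C * (C * t) - 2 * C * a + q by lra.
move: h; rewrite -(pmulr_rge0 _ C2); congr (0 <= _).
by field; rewrite gt_eqF.
Qed.

Lemma pd_lker A : pd A -> lker A == 0%VS.
Proof.
move=> pA; apply: injective_lker => v Av; apply/eqP; apply: contraT => /pA.
by rewrite Av inner0r ltxx.
Qed.

(** The form dominates a multiple of the squared norm of [A v], and [A] has a
    bounded inverse; this replaces the compactness of the unit sphere. *)
Lemma pd_coercive A : self_adjoint A -> pd A ->
  exists2 C : R, 0 < C & forall v, inner v v <= C * inner v (A v).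
Proof.
move=> saA pA.
have psdA : psd A.
  by move=> v; have [->|/pA/ltW//] := eqVneq v 0; rewrite inner0l.
have kA := pd_lker pA.
have [C C0 hC] := psd_form_bounds_image saA psdA.
have [E E0 hE] := hom_bounded (A^-1)%VF.
exists (E ^+ 2 * C); first by rewrite mulr_gt0 ?exprn_gt0.
move=> v; apply: (@le_trans _ _ (E ^+ 2 * inner (A v) (A v))).
  by apply: inner_le_sqr (ltW E0) _; rewrite -{1}[v](lker0_lfunK kA).
by rewrite -mulrA ler_pM2l ?exprn_gt0.
Qed.
End SelfAdjoint.

Lemma self_adjoint_conj (R : realType) (U V : euclidType R) (A : 'Hom(U, V))
    (B : 'End(U)) : self_adjoint B -> self_adjoint (A \o B \o adj A)%VF.
Proof.
move=> /self_adjointP sB; apply/self_adjointP => u v.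
by rewrite !comp_lfunE adjP sB adjPr.
Qed.

Section RangeProjection.
Variables (R : realType) (X Z : euclidType R) (G : 'Hom(X, Z)).

Lemma self_adjoint_gram : self_adjoint (G \o adj G)%VF.
Proof. by apply/self_adjointP => u v; rewrite !comp_lfunE adjP adjPr. Qed.

(** The orthogonal projection on the range of [adj G], in the form in which it
    occurs in [opT]. *)
Definition coimage_proj : 'End(X) :=
  (adj G \o moore_penrose (G \o adj G) \o G)%VF.

Lemma coimage_projE x :
  coimage_proj x = adj G (moore_penrose (G \o adj G)%VF (G x)).
Proof. by rewrite !comp_lfunE. Qed.

Lemma coimage_projK x : G (coimage_proj x) = G x.
Proof.
rewrite coimage_projE.
have [h1 _ h3 _] := moore_penroseP self_adjoint_gram.
set B := moore_penrose _ in h1 h3 *.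
apply: eq_inner => v.
have h1' w : G (adj G (B (G (adj G w)))) = G (adj G w).
  by move/(congr1 (fun h : 'End(Z) => h w)): h1; rewrite !comp_lfunE.
have -> : G (adj G (B (G x))) = (G \o adj G \o B)%VF (G x) by rewrite !comp_lfunE.
rewrite h3 !comp_lfunE /= adjP [RHS]adjP; congr (inner x _).
(* [w] is in the kernel of [G \o adj G], hence in that of [adj G] *)
pose w := G (adj G (B v)) - v.
have Gw : G (adj G w) = 0.
  apply: eq_inner => u; rewrite inner0l adjP adjPr.
  rewrite /w innerDl innerNl.
  have -> : G (adj G (B v)) = (G \o adj G \o B)%VF v by rewrite !comp_lfunE.
  by rewrite h3 !comp_lfunE /= h1' subrr.
apply/eqP; rewrite -subr_eq0 -linearB /= -/w; apply/eqP/inner_eq0.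
by rewrite adjPr Gw inner0r.
Qed.

Lemma coimage_proj_inner u v :
  inner u (coimage_proj v) = inner (coimage_proj u) (coimage_proj v).
Proof.
by rewrite !(coimage_projE v) -!adjP coimage_projK.
Qed.

Lemma self_adjoint_coimage_proj : self_adjoint coimage_proj.
Proof.
apply/self_adjointP => u v.
by rewrite innerC coimage_proj_inner innerC -coimage_proj_inner.
Qed.

Lemma coimage_proj_adj z : coimage_proj (adj G z) = adj G z.
Proof.
pose d := coimage_proj (adj G z) - adj G z.
have Gd : G d = 0 by rewrite linearB /= coimage_projK subrr.
have [q dq] : exists q, d = adj G q.
  by rewrite /d coimage_projE -linearB; eexists.
apply/eqP; rewrite -subr_eq0; apply/eqP/inner_eq0.
by rewrite -/d {2}dq -adjP Gd inner0l.
Qed.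
End RangeProjection.

Section MetricProjection.
Variables (R : realType) (X Z : euclidType R) (G : 'Hom(X, Z)).

Definition range_proj : 'End(Z) := coimage_proj (adj G).

(** The theorem of Pythagoras shows that the orthogonal projection is a nearest
    point and that it is the only one. *)
Lemma metric_proj_range z : metric_proj (range G) z = range_proj z.
Proof.
have rP : range G (range_proj z).
  by rewrite /range_proj coimage_projE adjK; eexists.
have orth w : range G w -> inner (z - range_proj z) w = 0.
  case=> x _ <-; rewrite -adjPr linearB /= /range_proj coimage_projK subrr.
  by rewrite inner0l.
have pyth w : range G w -> enorm (z - w) ^+ 2 =
   enorm (z - range_proj z) ^+ 2 + enorm (range_proj z - w) ^+ 2.
  move=> rw; have rd : range G (range_proj z - w).
    by case: rP rw => [a _ <-] [a' _ <-]; exists (a - a') => //; rewrite linearB.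
  rewrite !enorm_sqr -[z - w](subrKA (range_proj z)).
  have := orth _ rd.
  move: (z - range_proj z) (range_proj z - w) => p q pq.
  by rewrite !innerE (innerC q p) pq addr0 add0r.
have mini w' : range G w' -> enorm (z - range_proj z) <= enorm (z - w').
  move=> /pyth h; rewrite -ler_sqr ?nnegrE ?enorm_ge0//.
  by rewrite h lerDl sqr_ge0.
rewrite /metric_proj; case: xgetP => [w _ [rw wmin]|/(_ (range_proj z))[]//].
have := wmin _ rP; rewrite -ler_sqr ?nnegrE ?enorm_ge0// (pyth _ rw) gerDl.
move=> h; apply/eqP; rewrite eq_sym -subr_eq0; apply/eqP/enorm_eq0/eqP.
by rewrite -sqrf_eq0 eq_le h sqr_ge0.
Qed.

Lemma adj_range_proj z : adj G (range_proj z) = adj G z.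
Proof. exact: coimage_projK. Qed.

Lemma range_proj_bounded :
  exists2 C : R, 0 < C & forall z, enorm (range_proj z) <= C * enorm (adj G z).
Proof.
have [C C0 hC] := hom_bounded (adj (adj G) \o
  moore_penrose (adj G \o adj (adj G)))%VF.
by exists C => // z; rewrite /range_proj coimage_projE; have := hC (adj G z);
  rewrite comp_lfunE.
Qed.
End MetricProjection.

(** * Subgradients, proximal maps and gradients *)

Lemma le0_of_small_steps (R : realType) (a c : R) :
  (forall t, 0 < t < 1 -> a <= t * c) -> a <= 0.
Proof.
move=> h; apply/ler_addgt0Pl => e e0; rewrite addr0.
have d0 : 0 < `|c| + e + 1 by rewrite !ltr_wpDl ?addr_ge0 ?(ltW e0).
pose t := e / (`|c| + e + 1).
have t01 : 0 < t < 1.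
  rewrite divr_gt0//= ltr_pdivrMr// mul1r.
  by have := normr_ge0 c; lra.
apply: le_trans (h t t01) _.
apply: le_trans (ler_norm _) _.
rewrite normrM gtr0_norm; last by case/andP: t01.
rewrite /t mulrAC ler_pdivrMr// ler_wpM2l ?(ltW e0)//; lra.
Qed.

Section Completeness.
Variables (R : realType) (V : euclidType R).

(** Coordinates are bounded functionals, so the sequence is Cauchy, hence
    convergent, in each coordinate. *)
Lemma enorm_complete (u : nat -> V) :
  (forall e : R, 0 < e -> exists N, forall m n, (N <= m)%N -> (N <= n)%N ->
     enorm (u m - u n) < e) ->
  exists l, forall e : R, 0 < e -> exists N, forall n, (N <= n)%N ->
    enorm (u n - l) < e.
Proof.
move=> hu; have [C C0 hC] := @coord_bounded R V.
pose b := vbasis {:V}.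
have cv i : cvgn (fun n => coord b i (u n) : R).
  apply/cauchy_cvgP/cauchy_exP => e e0.
  have C1 : 0 < C + 1 by rewrite ltr_wpDl.
  have [N hN] := hu (e / (C + 1)) (divr_gt0 e0 C1).
  exists (coord b i (u N)); exists N => // n /= Nn; rewrite /ball /=.
  rewrite -linearB; apply: le_lt_trans (hC _ _) _.
  apply: (@le_lt_trans _ _ ((C + 1) * enorm (u N - u n))).
    by rewrite ler_wpM2r ?enorm_ge0// lerDl.
  by rewrite mulrC -ltr_pdivlMr// hN.
pose c i := limn (fun n => coord b i (u n) : R).
exists (\sum_i c i *: b`_i) => e e0.
pose K := \sum_(i < \dim {:V}) enorm b`_i + 1.
have K0 : 0 < K by rewrite ltr_wpDl// sumr_ge0// => i _; exact: enorm_ge0.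
have [N _ hN] : \forall n \near \oo, forall i, `|c i - coord b i (u n)| < e / K.
  apply: filter_forall => i.
  by have /cvgrPdist_lt := cv i; apply; exact: divr_gt0.
exists N => n /hN {}hN; rewrite {1}(coord_vbasis (memvf (u n))) -sumrB.
apply: le_lt_trans (enorm_sum _ _ _) _.
apply: (@le_lt_trans _ _ (e / K * (K - 1))); last first.
  by rewrite mulrBr mulr1 divfK ?gt_eqF// ltrBlDr ltrDl divr_gt0.
rewrite /K addrK mulr_sumr; apply: ler_sum => i _.
rewrite -scalerBl enormZ distrC; apply: ler_wpM2r; first exact: enorm_ge0.
exact: ltW.
Qed.
End Completeness.

Section Subgradients.
Variables (R : realType) (V : euclidType R).
Implicit Types (th : V -> \bar R) (v g : V).

Lemma subdiff_monotone th v v' g g' :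
  subdiff th v g -> subdiff th v' g' -> 0 <= inner (g - g') (v - v').
Proof.
move=> [fv /(_ v') h] [fv' /(_ v) h'].
move: h h'; rewrite -(fineK fv) -(fineK fv') -!EFinD !lee_fin !innerE; lra.
Qed.

(** A first-order bound on a smooth summand removes it from the
    subdifferential: compare along short segments and use convexity. *)
Lemma subdiff_smooth_sum th (q : V -> R) v0 g0 g (C : R) :
  convex_ereal th ->
  (forall h, q (v0 + h) <= q v0 + inner g0 h + C * inner h h) ->
  subdiff (fun v => th v + (q v)%:E)%E v0 g -> subdiff th v0 (g - g0).
Proof.
move=> cth hq [fv hg].
have fth : th v0 \is a fin_num by move: fv; rewrite fin_numD => /andP[].
split=> // v'; case E : (th v') => [a1||]; last 2 first.
- by rewrite leey.
- move: (hg v'); rewrite E /= -(fineK fth) => /=.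
  by rewrite leeNy_eq.
have := fineK fth; set a0 := fine (th v0) => a0E.
rewrite -a0E -EFinD lee_fin -subr_le0.
apply: (@le0_of_small_steps _ _ (C * inner (v' - v0) (v' - v0))) => t t01.
have t0 : 0 < t by case/andP: t01.
have := cth t v' v0 t01; have := hg (v0 + t *: (v' - v0)).
have -> : t *: v' + (1 - t) *: v0 = v0 + t *: (v' - v0).
  by rewrite scalerBl scale1r scalerBr addrCA addrC -addrA addrC.
rewrite E -a0E -!EFinM -!EFinD => h1 h2.
have := le_trans h1 (leeD h2 (lexx (q (v0 + t *: (v' - v0)))%:E)).
rewrite -!EFinD lee_fin => h3.
have := hq (t *: (v' - v0)); rewrite [v0 + _ - v0]addrAC subrr add0r in h3.
move: h3; rewrite innerDl innerNl.
rewrite !(innerZr,innerZl) => h3 h4.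
rewrite -(ler_pM2l t0); lra.
Qed.

Lemma proper_ninfty th v : Defs.proper th -> (-oo < th v)%E.
Proof. by move=> [h _]; rewrite ltNye h. Qed.

(** Uniform convexity makes a minimizing sequence of the proximal objective
    Cauchy; closedness makes its limit a minimizer. *)
Lemma prox_exists th v0 g nu : closed_proper_convex th -> subdiff th v0 g ->
  exists l, argmin (fun v' => th v' + (2^-1 * enorm (nu - v') ^+ 2)%:E)%E l.
Proof.
move=> [cl pr cv] [f0 hg].
pose J v := fine (th v) + 2^-1 * enorm (nu - v) ^+ 2.
pose S := [set J v | v in [set v | th v \is a fin_num]].
have S0 : S !=set0 by exists (J v0); exists v0.
have finP v : (th v < +oo)%E -> th v \is a fin_num.
  by move=> h; rewrite fin_numElt h proper_ninfty.
have lbS : has_lbound S.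
  exists (fine (th v0) + inner g (nu - v0) - 2^-1 * inner g g) => _ [v /= fv <-].
  have := hg v; rewrite -(fineK f0) -(fineK fv) -EFinD lee_fin /J enorm_sqr.
  have := inner_ge0 (g + (v - nu)).
  rewrite !innerE !(innerC v nu) !(innerC v g) !(innerC nu g); lra.
have hS : has_inf S by [].
pose m := inf S.
have mJ v : th v \is a fin_num -> m <= J v.
  by move=> fv; apply: ge_inf => //; exists v.
have /choice[u hu] : forall n : nat, exists v, th v \is a fin_num /\
    J v < m + n.+1%:R^-1.
  move=> n; have n0 : 0 < n.+1%:R^-1 :> R by rewrite invr_gt0 ltr0n.
  have [_ [v fv <-] h] := inf_adherent n0 hS.
  by exists v.
have mid i j : enorm (u i - u j) ^+ 2 <= 4 * (i.+1%:R^-1 + j.+1%:R^-1).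
  have [fi hi] := hu i; have [fj hj] := hu j.
  pose w := 2^-1 *: u i + (1 - 2^-1) *: u j.
  have half : 0 < (2^-1 : R) < 1 by apply/andP; split; lra.
  have := cv 2^-1 (u i) (u j) half; rewrite -/w.
  rewrite -(fineK fi) -(fineK fj) -!EFinM -EFinD => hw.
  have fw : th w \is a fin_num by apply: finP; apply: le_lt_trans hw _; rewrite ltry.
  have := mJ _ fw; move: hw; rewrite -(fineK fw) lee_fin /J => hw.
  have par : 2^-1 * enorm (nu - w) ^+ 2 = 4^-1 * enorm (nu - u i) ^+ 2 +
      4^-1 * enorm (nu - u j) ^+ 2 - 8^-1 * enorm (u i - u j) ^+ 2.
    rewrite !enorm_sqr /w !innerE !(innerC (u i) nu) !(innerC (u j) nu).
    by rewrite !(innerC (u j) (u i)); field.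
  have h12 : 1 - 2^-1 = 2^-1 :> R by lra.
  move: hi hj hw; rewrite /J par h12.
  by move: (i.+1%:R^-1) (j.+1%:R^-1) => ei ej; lra.
have harch (e : R) : 0 < e -> exists N, forall n, (N <= n)%N -> n.+1%:R^-1 < e.
  move=> e0; exists (Num.truncn e^-1) => n hn.
  rewrite invf_plt ?posrE//.
  apply: lt_le_trans (truncnS_gt _) _; by rewrite ler_nat ltnS.
have [l hl] : exists l, forall e : R, 0 < e -> exists N, forall n, (N <= n)%N ->
    enorm (u n - l) < e.
  apply: enorm_complete => e e0.
  have e8 : 0 < 8^-1 * e ^+ 2 by rewrite mulr_gt0 ?exprn_gt0 ?invr_gt0.
  have [N hN] := harch _ e8.
  exists N => i j hi hj.
  rewrite -(ltr_pXn2r (_ : 0 < 2)%N) ?nnegrE ?enorm_ge0 ?(ltW e0)//.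
  apply: le_lt_trans (mid i j) _.
  have := hN i hi; have := hN j hj.
  by move: (i.+1%:R^-1) (j.+1%:R^-1) (e ^+ 2) => ei ej e2; lra.
have pl : (th l <= (m - 2^-1 * enorm (nu - l) ^+ 2)%:E)%E.
  rewrite leNgt; apply/negP => h.
  have [a /andP[ha1 ha2]] : exists a : R,
      ((m - 2^-1 * enorm (nu - l) ^+ 2)%:E < a%:E < th l)%E.
    move: h; case: (th l) => [r||] //=.
      by rewrite lte_fin => h; exists ((m - 2^-1 * enorm (nu - l) ^+ 2 + r) / 2);
        rewrite !lte_fin midf_lt//=; lra.
    by exists (m - 2^-1 * enorm (nu - l) ^+ 2 + 1); rewrite lte_fin ltrDl ltr01 ltry.
  move: ha1; rewrite lte_fin => ha1.
  have [d d0 hd] := cl _ _ ha2.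
  pose e := a - (m - 2^-1 * enorm (nu - l) ^+ 2).
  have e0 : 0 < e by rewrite subr_gt0.
  pose k := enorm (nu - l) + 1.
  have k0 : 0 < k by rewrite ltr_wpDl ?enorm_ge0.
  have [N1 h1] := hl d d0.
  have [N2 h2] := hl (e / (2 * k)) ltac:(by rewrite divr_gt0// mulr_gt0).
  have [N3 h3] := harch (e / 2) ltac:(by rewrite divr_gt0).
  pose n := maxn N1 (maxn N2 N3).
  have n1 : (N1 <= n)%N by rewrite leq_maxl.
  have n2 : (N2 <= n)%N by rewrite /n maxnCA leq_maxl.
  have n3 : (N3 <= n)%N by rewrite /n [maxn N2 N3]maxnC maxnCA leq_maxl.
  have [fn Jn] := hu n.
  have := hd _ (h1 n n1); rewrite -(fineK fn) lte_fin => an.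
  have := h3 n n3; have := h2 n n2; rewrite ltr_pdivlMr ?mulr_gt0// => h2n h3n.
  have := cauchy_schwarz (nu - l) (u n - l).
  have := enorm_ge0 (u n - l); have := enorm_ge0 (nu - l) => z1 z2.
  have : inner (nu - u n) (nu - u n) = inner (nu - l) (nu - l)
     - 2 * inner (nu - l) (u n - l) + inner (u n - l) (u n - l).
    rewrite -[nu - u n](subrKA l) -[l - u n]opprB.
    by move: (nu - l) (u n - l) => x y; rewrite !innerE (innerC y x); lra.
  have := inner_ge0 (u n - l); move: Jn h2n h3n; rewrite /J /e /k !enorm_sqr.
  move: (n.+1%:R^-1) (inner (u n - l) (u n - l)) => wn q + + + q0 i2 cs.
  rewrite i2; move: (inner (nu - l) (nu - l)) (inner (nu - l) _) cs => L c0 cs.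
  move: (enorm (nu - l)) (enorm (u n - l)) z1 z2 cs => A B A0 B0 cs J1 J2 J3.
  have J4 : B * (2 * (A + 1)) = 2 * (A * B) + 2 * B by ring.
  have J5 : 2^-1 * (L - 2 * c0 + q) = 2^-1 * L - c0 + 2^-1 * q by field.
  move: J1 J2; rewrite J4 J5; lra.
exists l => v.
have flt : (th l < +oo)%E by apply: le_lt_trans pl _; rewrite ltry.
have fl := finP _ flt.
have [fv|] := boolP (th v \is a fin_num); last first.
  rewrite fin_numElt proper_ninfty//= -leNgt leye_eq => /eqP ->.
  by rewrite addye// leey.
have := mJ v fv; move: pl; rewrite -(fineK fl) -(fineK fv) -!EFinD !lee_fin /J; lra.
Qed.

Lemma prox_subdiff th v0 g nu : closed_proper_convex th -> subdiff th v0 g ->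
  subdiff th (prox th nu) (nu - prox th nu).
Proof.
move=> cpc sg; have [l0 hl0] := prox_exists nu cpc sg.
have : argmin (fun v' => th v' + (2^-1 * enorm (nu - v') ^+ 2)%:E)%E (prox th nu).
  by rewrite /prox; case: xgetP => [l -> //|/(_ l0)].
move: (prox th nu) => l hl; have [_ pr cv] := cpc.
have -> : nu - l = 0 - (l - nu) by rewrite sub0r opprB.
apply: (@subdiff_smooth_sum _ (fun v => 2^-1 * enorm (nu - v) ^+ 2) _ _ _ 2^-1) => //.
  move=> h; rewrite !enorm_sqr !innerE !(innerC l nu) !(innerC h nu) !(innerC h l).
  lra.
split=> [|v]; last by rewrite inner0l adde0 hl.
rewrite fin_numD andbT fin_numElt proper_ninfty//=.
have [f0 _] := sg; have := hl v0; rewrite -(fineK f0) -EFinD.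
by case: (th l) => //= r; rewrite ltry.
Qed.

(** As [v] is the proximal point of [v + g], this is nonexpansiveness of the
    proximal map at [v + g] and [v - q]. *)
Lemma prox_error th v g q : closed_proper_convex th -> subdiff th v g ->
  enorm (v - prox th (v - q)) <= enorm (g + q).
Proof.
move=> cpc sg; have sl := prox_subdiff (v - q) cpc sg.
move: (prox _ _) sl => l sl.
have := subdiff_monotone sg sl.
have -> : g - (v - q - l) = (g + q) - (v - l).
  by rewrite [v - q - l]addrAC opprB addrA.
rewrite innerDl innerNl -enorm_sqr subr_ge0 => h.
have := le_trans h (cauchy_schwarz _ _).
have := enorm_ge0 (v - l); rewrite le_eqVlt => /orP[/eqP <-|n0].
  by rewrite enorm_ge0.
by rewrite expr2 ler_pM2r.
Qed.
End Subgradients.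

Section Gradients.
Variables (R : realType) (V : euclidType R).
Implicit Types (f : V -> R).

Lemma gradient_unique f v g g' :
  is_gradient f v g -> is_gradient f v g' -> g = g'.
Proof.
move=> hg hg'; apply/eqP; rewrite -subr_eq0; apply/eqP/inner_eq0/eqP.
rewrite eq_le inner_ge0 andbT; set k := g - g'.
apply/ler_addgt0Pl => e e0; rewrite addr0.
have n0 : 0 < 2 * (enorm k + 1) by rewrite mulr_gt0// ltr_wpDl ?enorm_ge0.
have [d d0 hd] := hg (e / (2 * (enorm k + 1))) (divr_gt0 e0 n0).
have [d' d'0 hd'] := hg' (e / (2 * (enorm k + 1))) (divr_gt0 e0 n0).
(* [t] is small enough for the point [v + t *: (g - g')] to be in both ranges *)
pose t := Num.min d d' / (2 * (enorm k + 1)).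
have m0 : 0 < Num.min d d' by rewrite lt_min d0.
have t0 : 0 < t by rewrite divr_gt0.
have tk : enorm (t *: k) < Num.min d d'.
  rewrite enormZ gtr0_norm// /t mulrAC ltr_pdivrMr// ltr_pM2l//.
  by have := enorm_ge0 k; lra.
move: tk; rewrite lt_min => /andP[/hd h /hd' h'].
have : t * inner k k <= t * e.
  move: h h'; rewrite !ler_norml enormZ gtr0_norm// !innerZr.
  have -> : inner k k = inner g k - inner g' k by rewrite {1}/k innerDl innerNl.
  set E := e / _ => /andP[h1 h2] /andP[h3 h4].
  have : t * (E * (2 * enorm k)) <= t * e.
    rewrite ler_pM2l// /E mulrAC ler_pdivrMr//. rewrite ler_pM2l//; lra.
  rewrite mulrBr; lra.
by rewrite ler_pM2l.
Qed.

Lemma grad_gradient f v g : is_gradient f v g -> grad f v = g.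
Proof.
move=> hg; rewrite /grad; case: xgetP => [g' _ h|/(_ g)//].
exact: gradient_unique h hg.
Qed.

Lemma convex_gradient f v v' g : convex_real f -> is_gradient f v g ->
  f v + inner g (v' - v) <= f v'.
Proof.
move=> cf hg; rewrite -subr_le0; apply/ler_addgt0Pl => e e0; rewrite addr0.
set h := v' - v.
have n0 : 0 < enorm h + 1 by rewrite ltr_wpDl ?enorm_ge0.
have [d d0 hd] := hg (e / (enorm h + 1)) (divr_gt0 e0 n0).
pose t := Num.min (2^-1) (d / (2 * (enorm h + 1))).
have t0 : 0 < t by rewrite lt_min invr_gt0 ltr0n /= divr_gt0 ?mulr_gt0.
have t1 : t <= 2^-1 by rewrite ge_min lexx.
have td : enorm (t *: h) < d.
  rewrite enormZ gtr0_norm//; apply: (@le_lt_trans _ _ (d / (2 * (enorm h + 1)) * enorm h)).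
    by apply: ler_wpM2r; [exact: enorm_ge0 | rewrite ge_min lexx orbT].
  rewrite mulrAC ltr_pdivrMr ?mulr_gt0// ltr_pM2l//.
  by have := enorm_ge0 h; lra.
have := cf t v' v ltac:(apply/andP; split; [exact: ltW | lra]).
have -> : t *: v' + (1 - t) *: v = v + t *: h.
  by rewrite /h scalerBl scale1r scalerBr addrCA addrC -addrA addrC.
have := hd _ td; rewrite ler_norml enormZ gtr0_norm// innerZr => /andP[h1 _] h2.
have h3 : e / (enorm h + 1) * (t * enorm h) <= t * e.
  rewrite mulrCA ler_pM2l// mulrAC ler_pdivrMr//.
  rewrite ler_pM2l//; have := enorm_ge0 h; lra.
rewrite -(ler_pM2l t0); lra.
Qed.

(** At [u - h], the majorant built at [u] lies above the tangent taken at [v]; at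
    [v + h], the majorant built at [v] lies above the tangent taken at [u].  With
    [h] half of [u - w], the sum of the two inequalities pairs the difference of the
    gradients with [w - v]. *)
Lemma majorized_gradient f (S : 'End(V)) u v w gu gv :
  convex_real f -> is_gradient f u gu -> is_gradient f v gv ->
  (forall y, f y <= f u + inner gu (y - u) + 2^-1 * inner (y - u) (S (y - u))) ->
  (forall y, f y <= f v + inner gv (y - v) + 2^-1 * inner (y - v) (S (y - v))) ->
  - (4^-1 * inner (w - u) (S (w - u))) <= inner (gu - gv) (w - v).
Proof.
move=> cf hu hv mu mv; have [h hE] : exists h, h = 2^-1 *: (u - w) by eexists.
have a1 := mu (u - h); have a2 := mv (v + h).
have b1 := convex_gradient (u - h) cf hv; have b2 := convex_gradient (v + h) cf hu.
have e1 : u - h - u = - h by rewrite addrAC subrr add0r.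
have e2 : v + h - v = h by rewrite addrAC subrr add0r.
rewrite e1 in a1; rewrite e2 in a2.
have e3 : u - h - v = (u - v) - h by rewrite addrAC.
have e4 : v + h - u = h - (u - v) by rewrite opprB [v + h]addrC addrA.
rewrite e3 in b1; rewrite e4 in b2.
have Sh : inner h (S h) = 4^-1 * inner (w - u) (S (w - u)).
  rewrite hE -(opprB w u) [S (_ *: _)]linearZ /= [S (- _)]linearN /= !innerE.
  by field.
have wv : inner (gu - gv) (w - v) = inner (gu - gv) (u - v) - 2 * inner (gu - gv) h.
  have -> : w - v = (u - v) - 2 *: h.
    by rewrite hE scalerA divff ?pnatr_eq0// scale1r opprB [RHS]addrC subrKA.
  by rewrite innerDr innerNr innerZr.
rewrite -Sh wv; move: a1 a2 b1 b2; rewrite [S (- _)]linearN /= !innerE; lra.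
Qed.
End Gradients.

(** * Block operators and symmetric Gauss-Seidel sweeps *)

Section Blocks.
Variables (R : realType) (n : nat) (Y : 'I_n -> euclidType R).
Local Notation prodY := {dffun forall i, Y i}.
Implicit Types (y w : prodY) (A N : 'End(prodY)).

Lemma inner_blockE y w : inner y w = \sum_i inner (y i) (w i).
Proof. by []. Qed.
Lemma blockD y w i : (y + w) i = y i + w i. Proof. by rewrite ffunE. Qed.
Lemma blockN y i : (- y) i = - y i. Proof. by rewrite ffunE. Qed.
Lemma blockZ (a : R) y i : (a *: y) i = a *: y i. Proof. by rewrite ffunE. Qed.
Lemma block0 i : (0 : prodY) i = 0. Proof. by rewrite ffunE. Qed.

Lemma eq_block y w : (forall i, y i = w i) -> y = w.
Proof. by move=> h; apply/ffunP. Qed.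

Lemma block_neq0 y : y != 0 -> exists i, y i != 0.
Proof.
move=> y0; apply/existsP; apply: contraT; rewrite negb_exists => /forallP h.
case/eqP: y0; apply: eq_block => i; rewrite block0; apply/eqP.
by have := h i; rewrite negbK.
Qed.

Lemma sum_blockE I (r : seq I) (P : pred I) (G : I -> prodY) i :
  (\sum_(k <- r | P k) G k) i = \sum_(k <- r | P k) G k i.
Proof. by rewrite -bprojE linear_sum; apply: eq_bigr => k _ /=; rewrite bprojE. Qed.

Lemma binj_same i (v : Y i) : binj Y i v i = v.
Proof. by rewrite binjE eqtype.dfwith_in. Qed.
Lemma binj_other i (v : Y i) j : i != j -> binj Y i v j = 0.
Proof. by move=> ij; rewrite binjE eqtype.dfwith_out. Qed.

Lemma inner_binj i (v : Y i) y : inner (binj Y i v) y = inner v (y i).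
Proof.
rewrite inner_blockE (bigD1 i)//= binj_same big1 ?addr0// => j ji.
by rewrite binj_other 1?eq_sym// inner0l.
Qed.

Lemma sum_binj y : y = \sum_i binj Y i (y i).
Proof.
apply: eq_block => i; rewrite sum_blockE (bigD1 i)//= binj_same big1 ?addr0//.
by move=> j ji; rewrite binj_other.
Qed.

Lemma block_eval A i j v : block A i j v = A (binj Y j v) i.
Proof. by rewrite /block !comp_lfunE bprojE. Qed.

Lemma apply_blocks A y i : A y i = \sum_j block A i j (y j).
Proof.
rewrite {1}(sum_binj y) linear_sum sum_blockE.
by apply: eq_bigr => j _; rewrite block_eval.
Qed.

Lemma block_adj A i j (v : Y j) (v' : Y i) : self_adjoint A ->
  inner (block A i j v) v' = inner v (block A j i v').
Proof.
by move=> /self_adjointP sA; rewrite !block_eval innerC -inner_binj -sA innerC inner_binj.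
Qed.

Lemma bdiagE (B : forall i, 'End(Y i)) y i : bdiag B y i = B i (y i).
Proof.
rewrite /bdiag sum_lfunE sum_blockE (bigD1 i)//= !comp_lfunE bprojE binj_same.
rewrite big1 ?addr0// => j ji; rewrite !comp_lfunE binj_other//.
Qed.

Lemma diag_partE A y i : diag_part A y i = block A i i (y i).
Proof. by rewrite bdiagE. Qed.

Lemma upper_partE A y i :
  upper_part A y i = \sum_(j < n | (i < j)%N) block A i j (y j).
Proof.
rewrite /upper_part sum_lfunE sum_blockE (bigD1 i)//= [X in _ + X]big1 => [|k ki].
  rewrite addr0 sum_lfunE sum_blockE; apply: eq_bigr => j _.
  by rewrite 2!comp_lfunE bprojE binj_same.
rewrite sum_lfunE sum_blockE big1// => j _.
by rewrite 2!comp_lfunE binj_other.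
Qed.

Lemma adj_upper_partE A y i : self_adjoint A ->
  adj (upper_part A) y i = \sum_(j < n | (j < i)%N) block A i j (y j).
Proof.
move=> sA; apply: eq_inner => v.
rewrite innerC -inner_binj -adjP inner_blockE.
under eq_bigr => k _ do rewrite upper_partE.
rewrite (eq_bigr (fun k : 'I_n => if (k < i)%N
    then inner (block A k i v) (y k) else 0)) => [|k _].
  rewrite -big_mkcond innerC inner_sumr; apply: eq_bigr => k _.
  exact: block_adj.
case: ifP => ki.
  rewrite (bigD1 i)//= binj_same big1 ?addr0// => j /andP[_ ji].
  by rewrite binj_other 1?eq_sym// linear0.
rewrite big1 ?inner0l// => j kj; rewrite binj_other ?linear0//.
by apply: contraFN ki => /eqP ->.
Qed.

Lemma block_decomposition A y : self_adjoint A ->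
  A y = diag_part A y + upper_part A y + adj (upper_part A) y.
Proof.
move=> sA; apply: eq_block => i; rewrite !blockD diag_partE upper_partE.
rewrite adj_upper_partE// apply_blocks (bigD1 i)//= -addrA; congr (_ + _).
rewrite (bigID (fun j : 'I_n => (i < j)%N)) /=; congr (_ + _); apply: eq_bigl => j.
  by case: ltngtP => //; rewrite ?andbF// andbT -val_eqE /=; case: ltngtP.
by rewrite -val_eqE /=; case: ltngtP.
Qed.

Lemma bmix_lt i (lo : prodY) (v : Y i) (hi : prodY) (j : 'I_n) :
  (j < i)%N -> bmix lo v hi j = lo j.
Proof.
move=> ji; rewrite ffunE eqtype.dfwith_out ?ji//.
by apply: contraTneq ji => ->; rewrite ltnn.
Qed.
Lemma bmix_gt i (lo : prodY) (v : Y i) (hi : prodY) (j : 'I_n) :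
  (i < j)%N -> bmix lo v hi j = hi j.
Proof.
move=> ij; rewrite ffunE eqtype.dfwith_out ?ltnNge ?(ltnW ij)//.
by apply: contraTneq ij => ->; rewrite ltnn.
Qed.
Lemma bmix_eq i (lo : prodY) (v : Y i) (hi : prodY) : bmix lo v hi i = v.
Proof. by rewrite ffunE eqtype.dfwith_in. Qed.

Lemma bmixD i (lo : prodY) (v h : Y i) (hi : prodY) :
  bmix lo (v + h) hi = bmix lo v hi + binj Y i h.
Proof.
apply: eq_block => j; rewrite blockD.
case: (ltngtP i j) => [ij|ji|/val_inj <-].
- by rewrite !bmix_gt// binj_other ?addr0// -val_eqE neq_ltn ij.
- by rewrite !bmix_lt// binj_other ?addr0// -val_eqE neq_ltn ji orbT.
- by rewrite !bmix_eq binj_same.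
Qed.
End Blocks.

Section SymmetricGaussSeidel.
Variables (R : realType) (n : nat) (Y : 'I_n.+1 -> euclidType R).
Local Notation prodY := {dffun forall i, Y i}.
Variable N : 'End(prodY).
Hypotheses (saN : self_adjoint N) (dN : lker (diag_part N) == 0%VS).
Local Notation Nd := (diag_part N).
Local Notation Nu := (upper_part N).

(** The backward sweep minus the forward sweep expresses [Nd] applied to [yh - y1]
    through [y1 - y0] and the errors; this eliminates [yh] from the forward sweep
    and leaves the symmetric Gauss-Seidel term. *)
Lemma sGS_decomposition (q g y0 y1 yh d dt : prodY) :
  (forall i, i != ord0 -> dt i = (q + N (bmix y0 (yh i) yh - y0)) i) ->
  (forall i, d i = (g + q + N (bmix y1 (y1 i) yh - y0)) i) ->
  (forall i, i != ord0 -> g i = 0) -> dt ord0 = d ord0 ->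
  g + q + N (y1 - y0) + (Nu \o Nd^-1 \o adj Nu)%VF (y1 - y0)
    = d + (Nu \o Nd^-1)%VF (d - dt).
Proof.
move=> back fwd g0 d0; rewrite !comp_lfunE.
move: (Nd^-1)%VF (lker0_lfunK dN) => S SK.
(* block [ord0] of [yh] is replaced by that of [y1], which [Nu] cannot see *)
have [h hdef] : exists h, h = bmix y0 (y1 ord0) yh - y0 by eexists.
have NuE (w w' : prodY) (i : 'I_n.+1) :
    (forall j : 'I_n.+1, (i < j)%N -> w j = w' j) -> Nu w i = Nu w' i.
  by move=> e; rewrite !upper_partE; apply: eq_bigr => j ij; rewrite e.
have NlE (w w' : prodY) (i : 'I_n.+1) : (forall j : 'I_n.+1, (j < i)%N -> w j = w' j) ->
    adj Nu w i = adj Nu w' i.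
  by move=> e; rewrite !adj_upper_partE//; apply: eq_bigr => j ij; rewrite e.
have hE (j : 'I_n.+1) : (0 < j)%N -> h j = yh j - y0 j.
  by move=> j0; rewrite hdef blockD blockN bmix_gt.
have fwd' : d = g + q + (Nd (y1 - y0) + Nu h + adj Nu (y1 - y0)).
  apply: eq_block => i; rewrite fwd (block_decomposition _ saN) !blockD.
  congr (_ + (_ + _ + _)); last 1 first.
  - by apply: NlE => j ji; rewrite !blockD bmix_lt.
  - by rewrite !diag_partE !blockD bmix_eq.
  - apply: NuE => j ij; rewrite hE ?(leq_ltn_trans _ ij)//.
    by rewrite blockD blockN bmix_gt.
have back' : Nd (h - (y1 - y0)) = adj Nu (y1 - y0) - (d - dt).
  apply: eq_block => i; rewrite diag_partE !(blockD, blockN).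
  have [->|i0] := eqVneq i ord0.
    rewrite hdef !(blockD, blockN) bmix_eq subrr linear0 adj_upper_partE// big1//.
    by rewrite d0 subrr subr0.
  rewrite back// fwd' (block_decomposition _ saN) !(blockD, blockN) g0// add0r.
  have ip : (0 < i)%N by rewrite lt0n -(inj_eq val_inj) in i0 *.
  rewrite hE// !diag_partE !(blockD, blockN) bmix_eq.
  have -> : adj Nu (bmix y0 (yh i) yh - y0) i = 0.
    rewrite adj_upper_partE// big1// => j ji.
    by rewrite blockD blockN bmix_lt// subrr linear0.
  have -> : Nu (bmix y0 (yh i) yh - y0) i = Nu h i.
    apply: NuE => j ij; rewrite hE ?(leq_ltn_trans _ ij)//.
    by rewrite blockD blockN bmix_gt.
  rewrite addr0 linearB /=.
  move: (block N i i _) (block N i i _) (Nu h i) (q i) (adj Nu _ i) => a e r l m.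
  by vring.
have hE' : h = (y1 - y0) + S (adj Nu (y1 - y0) - (d - dt)).
  by rewrite -back' SK addrC subrK.
have NuhE : Nu h = Nu (y1 - y0) + Nu (S (adj Nu (y1 - y0)))
    - Nu (S (d - dt)).
  by rewrite {1}hE' [Nu (_ + _)]linearD /= [S _]linearB /= [Nu (S _ - _)]linearB /= addrA.
move: NuhE; move: (Nu (S (d - dt))) => r NuhE.
rewrite fwd' NuhE (block_decomposition _ saN).
move: (Nd (y1 - y0)) (Nu (y1 - y0)) (Nu _) => a b t.
by vring.
Qed.
End SymmetricGaussSeidel.

(** * Block subdifferentials of the augmented Lagrangian *)

Section AugmentedLagrangian.
Variables (R : realType) (X Z : euclidType R) (n : nat) (Y : 'I_n.+1 -> euclidType R).
Local Notation prodY := {dffun forall i, Y i}.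
Variables (p : Y ord0 -> \bar R) (f : prodY -> R) (Sigma : 'End(prodY)).
Variables (F : 'Hom(X, prodY)) (G : 'Hom(X, Z)) (b : Z) (c : X) (sigma : R).
Hypotheses (cp : convex_ereal p) (sS : self_adjoint Sigma).

Definition smooth_auglag (z : Z) (x : X) (y' y : prodY) : R :=
  fhat f Sigma y y' - inner b z + inner (adj F y + adj G z - c) x
  + sigma / 2 * enorm (adj F y + adj G z - c) ^+ 2.

Definition smooth_auglag_grad (z : Z) (x : X) (y' y : prodY) : prodY :=
  grad f y' + Sigma (y - y') + F x + sigma *: F (adj F y + adj G z - c).

Lemma smooth_auglag_expansion z x y' y h :
  smooth_auglag z x y' (y + h) =
  smooth_auglag z x y' y + inner (smooth_auglag_grad z x y' y) h
  + 2^-1 * inner h ((Sigma + sigma *: (F \o adj F)%VF) h).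
Proof.
rewrite /smooth_auglag /smooth_auglag_grad /fhat.
have -> : y + h - y' = (y - y') + h by rewrite addrAC.
have -> : adj F (y + h) + adj G z - c = (adj F y + adj G z - c) + adj F h.
  by rewrite [adj F (_ + _)]linearD /= -!addrA; congr (_ + _); rewrite addrC !addrA.
rewrite add_lfunE scale_lfunE comp_lfunE [Sigma (y - y' + h)]linearD /=.
have S1 a : inner a (Sigma h) = inner h (Sigma a).
  by rewrite -((self_adjointP Sigma).1 sS) innerC.
have F1 q : inner (adj F h) q = inner h (F q) by rewrite adjPr.
move: (y - y') (adj F y + adj G z - c) => a e.
rewrite !enorm_sqr !innerE (innerC e (adj F h)) !F1 S1.
rewrite !(innerC _ h); move: (adj F h) => k.
by field.
Qed.

Lemma bmix_affine i (lo hi : prodY) (v v' : Y i) (t : R) :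
  bmix lo (t *: v + (1 - t) *: v') hi = t *: bmix lo v hi + (1 - t) *: bmix lo v' hi.
Proof.
have E (w : Y i) : bmix lo w hi = @bmix R _ Y i lo 0 hi + binj Y i w.
  by rewrite -bmixD add0r.
rewrite !(E v) !(E v') E [binj Y i _]linearP /= [binj Y i (_ *: _)]linearZ /=.
by vring.
Qed.

(** The augmented Lagrangian is [p] plus a quadratic function of the block, whose
    second-order part is bounded. *)
Lemma auglag_block_subdiff i (lo hi : prodY) z x y' (v0 g : Y i) :
  subdiff (fun v => auglag p f Sigma F G b c sigma (bmix lo v hi) z x y') v0 g ->
  subdiff (fun v => p (bmix lo v hi ord0)) v0
    (g - smooth_auglag_grad z x y' (bmix lo v0 hi) i).
Proof.
have [C C0 hC] := form_bounded (Sigma + sigma *: (F \o adj F)%VF).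
apply: (@subdiff_smooth_sum _ _ _ (fun v => smooth_auglag z x y' (bmix lo v hi))
  _ _ _ (2^-1 * C)).
  by move=> t v v' t01; rewrite bmix_affine blockD !blockZ; exact: cp.
move=> h; rewrite bmixD smooth_auglag_expansion innerC inner_binj innerC.
rewrite lerD2l -mulrA ler_wpM2l//.
by have := hC (binj Y i h); rewrite [X in _ <= _ * X]inner_binj binj_same.
Qed.

Lemma auglag_subdiff_smooth_block i (lo hi : prodY) z x y' (v0 g : Y i) :
  i != ord0 ->
  subdiff (fun v => auglag p f Sigma F G b c sigma (bmix lo v hi) z x y') v0 g ->
  g = smooth_auglag_grad z x y' (bmix lo v0 hi) i.
Proof.
move=> i0 /auglag_block_subdiff[fin].
set g' := g - _ => h0; have := h0 (v0 + g').
have ip : ((ord0 : 'I_n.+1) < i)%N by rewrite lt0n.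
move: fin; rewrite !bmix_lt// => fin.
rewrite addrAC subrr add0r -(fineK fin) -EFinD lee_fin gerDl => h.
have : g' = 0 by apply: inner_eq0; apply/eqP; rewrite eq_le inner_ge0 h.
by move=> /eqP; rewrite subr_eq0 => /eqP.
Qed.

Lemma auglag_subdiff_first_block (lo hi : prodY) z x y' (v0 g : Y ord0) :
  subdiff (fun v => auglag p f Sigma F G b c sigma (bmix lo v hi) z x y') v0 g ->
  subdiff p v0 (g - smooth_auglag_grad z x y' (bmix lo v0 hi) ord0).
Proof.
move=> /auglag_block_subdiff.
by under [X in subdiff X]funext => v do rewrite bmix_eq.
Qed.
End AugmentedLagrangian.

(** * The proximal metric *)

Section Operators.
Variables (R : realType) (X Z : euclidType R) (n : nat) (Y : 'I_n.+1 -> euclidType R).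
Local Notation prodY := {dffun forall i, Y i}.
Variables (Sigma : 'End(prodY)) (F : 'Hom(X, prodY)) (G : 'Hom(X, Z)).
Variables (sigma : R) (D : forall i, 'End(Y i)).
Hypotheses (sS : self_adjoint Sigma) (pS : psd Sigma) (sigma0 : 0 < sigma).
Hypothesis sD : forall i, self_adjoint (D i).
Hypothesis pdD : forall i, pd (2^-1 *: block Sigma i i
  + sigma *: ((bproj Y i \o F) \o adj (bproj Y i \o F))%VF + D i).
Hypothesis psdD : psd (bdiag D + 2^-1 *: Sigma).

Local Notation N := (opN Sigma F sigma D).
Local Notation Nd := (diag_part N).
Local Notation Nu := (upper_part N).
Local Notation NsGS := (opNsGS Sigma F sigma D).

Lemma inner_gram (F' : 'Hom(X, prodY)) u v :
  inner (F' (adj F' u)) v = inner (adj F' u) (adj F' v).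
Proof. exact: adjP. Qed.

Lemma self_adjoint_bdiag : self_adjoint (bdiag D).
Proof.
apply/self_adjointP => u v; rewrite !inner_blockE; apply: eq_bigr => i _.
by rewrite !bdiagE; apply: (self_adjointP (D i)).1.
Qed.

Lemma opNE y : N y = Sigma y + sigma *: F (adj F y) + bdiag D y.
Proof. by rewrite /opN 2!add_lfunE scale_lfunE comp_lfunE. Qed.

Lemma self_adjoint_opN : self_adjoint N.
Proof.
apply: self_adjointD self_adjoint_bdiag; apply: self_adjointD => //.
exact/self_adjointZ/self_adjoint_gram.
Qed.

Lemma opN_block_form i (v : Y i) : inner v (block N i i v) =
  inner (binj Y i v) (Sigma (binj Y i v))
  + sigma * inner (adj F (binj Y i v)) (adj F (binj Y i v)) + inner v (D i v).
Proof.
rewrite block_eval -inner_binj opNE !innerE; congr (_ + _ + _).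
  by rewrite innerC inner_gram.
by rewrite inner_binj bdiagE binj_same.
Qed.

Lemma block_pd i (v : Y i) : v != 0 ->
  0 < 2^-1 * inner (binj Y i v) (Sigma (binj Y i v))
  + sigma * inner (adj F (binj Y i v)) (adj F (binj Y i v)) + inner v (D i v).
Proof.
have e : adj (bproj Y i \o F)%VF v = adj F (binj Y i v).
  apply: eq_inner => w.
  by rewrite adjPr comp_lfunE bprojE -inner_binj -adjPr.
move=> /pdD; rewrite 2!add_lfunE 2!scale_lfunE block_eval !innerE.
by rewrite -inner_binj comp_lfunE -(adjPr (bproj Y i \o F)%VF) e.
Qed.

Lemma diag_part_pd : pd Nd.
Proof.
move=> y y0; rewrite inner_blockE.
have [i yi] := block_neq0 y0.
have ge0 j : 0 <= inner (y j) (block N j j (y j)).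
  have [->|/block_pd h] := eqVneq (y j) 0; first by rewrite inner0l.
  rewrite opN_block_form; have := pS (binj Y j (y j)); lra.
rewrite (bigD1 i)//= diag_partE; apply: ltr_wpDr.
  by apply: sumr_ge0 => j _; rewrite diag_partE.
by rewrite opN_block_form; have := pS (binj Y i (y i)); have := block_pd yi; lra.
Qed.

Lemma self_adjoint_diag_part : self_adjoint Nd.
Proof.
apply/self_adjointP => u v; rewrite !inner_blockE; apply: eq_bigr => i _.
by rewrite !diag_partE; exact: block_adj self_adjoint_opN.
Qed.

Lemma opNsGS_form y (r := (Nd^-1)%VF (adj Nu y)) : inner y (NsGS y) = inner r (Nd r).
Proof.
rewrite /opNsGS 2!comp_lfunE -adjPr -/r innerC.
by rewrite /r (lker0_lfunVK (pd_lker diag_part_pd)).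
Qed.

Lemma self_adjoint_opNsGS : self_adjoint NsGS.
Proof.
apply: self_adjoint_conj; apply/self_adjointP => a c.
have SV := lker0_lfunVK (pd_lker diag_part_pd).
rewrite -[c in LHS]SV -[a in RHS]SV; symmetry.
exact: (self_adjointP Nd).1 self_adjoint_diag_part _ _.
Qed.

Lemma opNsGS_psd : psd NsGS.
Proof.
move=> y; rewrite opNsGS_form; move: (Nd^-1%VF _) => r.
by have [->|/diag_part_pd/ltW//] := eqVneq r 0; rewrite inner0l.
Qed.

Lemma opNsGS_eq0 y : inner y (NsGS y) = 0 -> adj Nu y = 0.
Proof.
rewrite opNsGS_form => h.
have : (Nd^-1)%VF (adj Nu y) = 0.
  by apply: contra_eq h => /diag_part_pd; rewrite lt0r => /andP[].
move=> /(congr1 Nd); rewrite lker0_lfunVK ?linear0//.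
exact: pd_lker diag_part_pd.
Qed.

(** This is the operator [opB] below with the projection on the range of [adj G]
    replaced by the identity. *)
Definition opQ : 'End(prodY) :=
  bdiag D + 2^-1 *: Sigma + NsGS + sigma *: (F \o adj F)%VF.

Lemma opQ_form y : inner y (opQ y) = inner y ((bdiag D + 2^-1 *: Sigma) y)
  + inner y (NsGS y) + sigma * inner (adj F y) (adj F y).
Proof.
rewrite /opQ add_lfunE (add_lfunE _ NsGS) 2!innerDr; congr (_ + _).
by rewrite scale_lfunE comp_lfunE innerZr innerC inner_gram.
Qed.

Lemma self_adjoint_half : self_adjoint (bdiag D + 2^-1 *: Sigma).
Proof. exact: self_adjointD self_adjoint_bdiag (self_adjointZ _ sS). Qed.

Lemma self_adjoint_opQ : self_adjoint opQ.
Proof.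
apply: self_adjointD; last exact/self_adjointZ/self_adjoint_gram.
exact: self_adjointD self_adjoint_half self_adjoint_opNsGS.
Qed.

(** Suppose the form vanishes at [y]; then so do its three nonnegative parts, which
    gives [adj F y = 0] and [adj Nu y = 0], and the forms of [D] and [- Sigma / 2]
    agree at [y].  By the second equation the forms of [N] and [Nd] agree at [y],
    so the forms of [Nd] and [D] at [y] add up to zero.  But block by block that
    sum is the positive definite form of [block_pd] plus a value of the form of
    [D + Sigma / 2]. *)
Lemma opQ_pd : pd opQ.
Proof.
move=> y y0; have q1 := psdD y; have q2 := opNsGS_psd y.
have q3 : 0 <= sigma * inner (adj F y) (adj F y).
  by rewrite mulr_ge0 ?inner_ge0// ltW.
rewrite opQ_form lt0r !addr_ge0// andbT; apply/negP => /eqP h.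
have h1 : inner y ((bdiag D + 2^-1 *: Sigma) y) = 0 by lra.
have h2 : adj Nu y = 0 by apply: opNsGS_eq0; lra.
have h3 : inner (adj F y) (adj F y) = 0.
  by have /eqP : sigma * inner (adj F y) (adj F y) = 0 by [lra];
     rewrite mulf_eq0 gt_eqF//= => /eqP.
have e1 : inner y (N y) = inner y (Nd y).
  rewrite (block_decomposition _ self_adjoint_opN) !innerDr -(adjPr Nu) h2.
  by rewrite inner0l inner0r !addr0.
have e2 : inner y (N y) = inner y (Sigma y) + inner y (bdiag D y).
  by rewrite opNE !innerE (innerC y (F _)) inner_gram h3 mulr0 addr0.
move: h1; rewrite add_lfunE scale_lfunE !innerE => h1.
have e3 : inner y (Nd y) + inner y (bdiag D y) = 0 by rewrite -e1 e2; lra.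
have t1 i : 0 <= 2^-1 * inner (binj Y i (y i)) (Sigma (binj Y i (y i)))
   + inner (y i) (D i (y i)).
  have := psdD (binj Y i (y i)); rewrite add_lfunE scale_lfunE !innerE.
  by rewrite (inner_binj _ (bdiag D _)) bdiagE binj_same addrC.
have [i yi] := block_neq0 y0.
suff : 0 < inner y (Nd y) + inner y (bdiag D y) by rewrite e3 ltxx.
have tE j : inner (y j) (Nd y j) + inner (y j) (bdiag D y j) =
   (2^-1 * inner (binj Y j (y j)) (Sigma (binj Y j (y j)))
    + sigma * inner (adj F (binj Y j (y j))) (adj F (binj Y j (y j)))
    + inner (y j) (D j (y j)))
   + (2^-1 * inner (binj Y j (y j)) (Sigma (binj Y j (y j)))
     + inner (y j) (D j (y j))).
  by rewrite diag_partE opN_block_form bdiagE; lra.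
rewrite !inner_blockE -big_split /= (bigD1 i)//= ltr_wpDr//.
  apply: sumr_ge0 => j _; rewrite tE addr_ge0//.
  have [->|/block_pd/ltW//] := eqVneq (y j) 0.
  by rewrite !linear0 !inner0l !mulr0 !addr0.
by rewrite tE ltr_wpDr// block_pd.
Qed.

(** The metric of the proximal term in [y] once [z] has been eliminated: the
    [y]-part of [opP] plus [opT]. *)
Definition opM : 'End(prodY) :=
  Sigma + (bdiag D + NsGS + sigma *: (F \o coimage_proj G \o adj F)%VF).

(** What remains of the metric after paying for the majorization of [f]. *)
Definition opB : 'End(prodY) := opM - 2^-1 *: Sigma.

Lemma opME y : opM y = Sigma y + bdiag D y + NsGS y
  + sigma *: F (coimage_proj G (adj F y)).
Proof.
rewrite /opM; move: NsGS (bdiag D) (coimage_proj G) => A B P.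
by rewrite 3!add_lfunE scale_lfunE 2!comp_lfunE !addrA.
Qed.

Lemma inner_opT w : inner w.1 ((bdiag D + NsGS + sigma *:
    (F \o adj G \o moore_penrose (G \o adj G) \o G \o adj F)%VF) w.1)
  + inner w.1 (Sigma w.1) = inner (w : prodY * Z).1 (opM w.1).
Proof.
rewrite addrC -innerDr /opM /coimage_proj; move: NsGS (bdiag D) => A B.
by rewrite 5!add_lfunE !scale_lfunE !comp_lfunE.
Qed.

Lemma self_adjoint_opM : self_adjoint opM.
Proof.
apply: self_adjointD => //; apply: self_adjointD.
  exact: self_adjointD self_adjoint_bdiag self_adjoint_opNsGS.
exact/self_adjointZ/self_adjoint_conj/self_adjoint_coimage_proj.
Qed.

Lemma opB_form y : inner y (opB y) = inner y ((bdiag D + 2^-1 *: Sigma) y)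
  + inner y (NsGS y)
  + sigma * inner (coimage_proj G (adj F y)) (coimage_proj G (adj F y)).
Proof.
rewrite /opB add_lfunE opp_lfunE scale_lfunE opME add_lfunE scale_lfunE !innerE.
rewrite -(adjPr F) coimage_proj_inner; lra.
Qed.

Lemma opB_psd : psd opB.
Proof.
move=> y; rewrite opB_form !addr_ge0 ?psdD ?opNsGS_psd//.
by rewrite mulr_ge0 ?inner_ge0// ltW.
Qed.

Lemma opM_ge_opB y : inner y (opB y) <= inner y (opM y).
Proof.
rewrite /opB add_lfunE opp_lfunE scale_lfunE !innerE gerBl.
by rewrite mulr_ge0.
Qed.

(** Subtracting from [adj F y + adj G z] its projection on the range of [adj G]
    leaves the component of [adj F y] that [opB] does not see, so the right-hand
    side dominates the positive definite form of [opQ].  This bounds [y], and then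
    the difference [adj G z], on which the projection of [z] depends boundedly. *)
Lemma opB_coercive : exists2 C : R, 0 < C & forall y z,
  inner y y + inner (range_proj G z) (range_proj G z)
  <= C * (inner y (opB y) + inner (adj F y + adj G z) (adj F y + adj G z)).
Proof.
have [C1 C10 hC1] := pd_coercive self_adjoint_opQ opQ_pd.
have [C2 C20 hC2] := hom_bounded (adj F).
have [C3 C30 hC3] := range_proj_bounded G.
(* [m] bounds both the factor of the form of [opB] and that of the residual, which
   enters [opQ] with the factor [sigma] *)
pose m := 1 + sigma.
have m0 : 0 < m by rewrite addr_gt0.
have key y z : inner y y <=
    C1 * m * (inner y (opB y) + inner (adj F y + adj G z) (adj F y + adj G z)).
  apply: le_trans (hC1 y) _; rewrite -mulrA ler_pM2l// opQ_form opB_form.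
  have orth (a : X) : inner a a = inner (coimage_proj G a) (coimage_proj G a)
     + inner (a - coimage_proj G a) (a - coimage_proj G a).
    have := coimage_proj_inner G a a; move: (coimage_proj G a) => t.
    by rewrite !innerE (innerC t a); lra.
  have kill : adj F y + adj G z - coimage_proj G (adj F y + adj G z) =
      adj F y - coimage_proj G (adj F y).
    rewrite [coimage_proj G _]linearD /= coimage_proj_adj.
    by vring.
  rewrite (orth (adj F y)) (orth (adj F y + adj G z)) kill.
  have := psdD y; have := opNsGS_psd y.
  have := inner_ge0 (coimage_proj G (adj F y)).
  have := inner_ge0 (coimage_proj G (adj F y + adj G z)).
  have := inner_ge0 (adj F y - coimage_proj G (adj F y)).
  set q := inner (adj F y - _) _; set a := inner (coimage_proj G (_ + _)) _.
  set t := inner (coimage_proj G _) _.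
  set u := inner y (NsGS y); set v := inner y _ => q0 a0 t0 u0 v0.
  have s0 := ltW sigma0; have s2 := mulr_ge0 s0 t0.
  have := mulr_ge0 s0 a0; have := mulr_ge0 s0 u0; have := mulr_ge0 s0 v0.
  by have := mulr_ge0 s0 s2; rewrite /m; nra.
exists (C1 * m + 2 * C3 ^+ 2 * (1 + C2 ^+ 2 * (C1 * m))).
  by rewrite addr_gt0 ?mulr_gt0 ?addr_gt0 ?mulr_gt0 ?exprn_gt0.
move=> y z; have h := key y z.
have nn := inner_ge0 (adj F y + adj G z); have nB := opB_psd y.
set B := inner y _ + inner _ _ in h *.
have hB : inner (adj F y + adj G z) (adj F y + adj G z) <= B by rewrite lerDr.
have g1 : inner (adj G z) (adj G z) <= 2 * B + 2 * (C2 ^+ 2 * inner y y).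
  have := inner_le_sqr (ltW C20) (hC2 y).
  have := inner_ge0 (2 *: adj F y + adj G z).
  move: hB; rewrite !innerE (innerC (adj G z)); lra.
have g2 : inner (range_proj G z) (range_proj G z) <= C3 ^+ 2 * inner (adj G z) (adj G z).
  exact: inner_le_sqr (ltW C30) (hC3 z).
rewrite mulrDl lerD//; apply: le_trans g2 _.
have -> : 2 * C3 ^+ 2 * (1 + C2 ^+ 2 * (C1 * m)) * B
  = C3 ^+ 2 * (2 * B + 2 * (C2 ^+ 2 * (C1 * m * B))) by ring.
rewrite ler_pM2l ?exprn_gt0//; apply: le_trans g1 _.
by rewrite lerD2l ler_pM2l// ler_pM2l ?exprn_gt0.
Qed.
End Operators.

(** * One step of the proximal augmented Lagrangian method *)

Section OneStep.
Variables (R : realType) (X Z : euclidType R) (n : nat) (Y : 'I_n.+1 -> euclidType R).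
Local Notation prodY := {dffun forall i, Y i}.
Variables (p : Y ord0 -> \bar R) (f : prodY -> R) (Sigma : 'End(prodY)).
Variables (F : 'Hom(X, prodY)) (G : 'Hom(X, Z)) (b : Z) (c : X).
Variables (sigma tau : R) (D : forall i, 'End(Y i)).
Hypotheses (cpc : closed_proper_convex p) (cf : convex_real f).
Hypothesis (df : forall v, exists g, is_gradient f v g).
Hypothesis (mf : majorized f Sigma).

Lemma gradP v : is_gradient f v (grad f v).
Proof. by have [g hg] := df v; rewrite (grad_gradient hg). Qed.

Lemma enorm_block (y : prodY) i : enorm (y i) <= enorm y.
Proof.
apply: enorm_le_sqr (enorm_ge0 _) _; rewrite enorm_sqr inner_blockE.
by rewrite (bigD1 i)//= lerDl sumr_ge0// => j _; exact: inner_ge0.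
Qed.

Lemma first_block_cpc :
  closed_proper_convex (fun w : prodY * Z => p (w.1 ord0)).
Proof.
have [cl [nN [v0 hv0]] cv] := cpc; split.
- move=> w a /cl[d d0 hd]; exists d => // w' hw'; apply: hd.
  apply: le_lt_trans hw'; apply: le_trans (enorm_fst (w' - w)).
  by rewrite -blockN -blockD; exact: enorm_block.
- split=> [w|]; first exact: nN.
  by exists (binj Y ord0 v0, 0); rewrite /= binj_same.
- by move=> t w w' t01; rewrite /= blockD !blockZ; exact: cv.
Qed.

Lemma objective_gradient (w : prodY * Z) :
  grad (fun w : prodY * Z => f w.1 - inner b w.2) w = (grad f w.1, - b).
Proof.
apply: grad_gradient => e e0; have [d d0 hd] := gradP w.1 e0.
exists d => // h hh; have h1 := le_lt_trans (enorm_fst h) hh.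
have := hd _ h1; rewrite inner_pairE /= innerNl innerDr.
move=> hle; apply: le_trans (le_trans hle _); last first.
  by apply: ler_wpM2l; [exact: ltW | exact: enorm_fst].
by rewrite le_eqVlt; apply/orP; left; apply/eqP; congr `|_|; ring.
Qed.

Variables (x0 x1 : X) (y0 y1 : prodY) (z1 : Z) (g dh : prodY).
Local Notation e1 := (adj F y1 + adj G z1 - c).
Local Notation M := (opM Sigma F G sigma D).
Local Notation B := (opB Sigma F G sigma D).
Hypothesis Hx : x1 = x0 + (tau * sigma) *: e1.
Hypothesis Hg : g = dh - grad f y0 - F (x0 + sigma *: e1) - M (y1 - y0).
Hypothesis Hsub : subdiff p (y1 ord0) (g ord0).
Hypothesis Hg0 : forall i, i != ord0 -> g i = 0.
Hypotheses (HG0 : G x0 = b) (HG1 : G e1 = 0).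

Lemma supported_first_block : g = binj Y ord0 (g ord0).
Proof.
apply: eq_block => i; have [->|i0] := eqVneq i ord0; first by rewrite binj_same.
by rewrite Hg0// binj_other// eq_sym.
Qed.

(** [g] is a subgradient at [y1], so by nonexpansiveness of the proximal map the
    second residual is at most the distance from [g] to minus the gradient of the
    smooth part; its [z] component vanishes because [G x1 = b]. *)
Lemma kkt_residual_bound zz : adj G zz = adj G z1 ->
  enorm (kkt_residual p f F G b c (x1, (y1, zz)))
  <= enorm e1 + enorm (g + (grad f y1 + F x1)).
Proof.
move=> hz; apply: le_trans (enorm_pair _) _; rewrite /kkt_residual /opAadj /=.
rewrite hz -[leLHS]addr0 -addrA lerD//; first by rewrite enormBC.
rewrite addr0 objective_gradient /opA /=.
have Gx : G x1 = b.
  by rewrite Hx linearD /= linearZ /= HG1 scaler0 addr0.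
set w := (y1, zz).
have -> : w - (grad f y1, - b) - (F x1, G x1) = w - (grad f y1 + F x1, 0).
  rewrite Gx -addrA -opprD; congr (_ - _).
  by apply/eqP; rewrite xpair_eqE /= addNr !eqxx.
have sub : subdiff (fun w : prodY * Z => p (w.1 ord0)) w (g, 0).
  have [fin h] := Hsub; split=> // w'; rewrite inner_pairE /= inner0l addr0.
  by rewrite supported_first_block inner_binj blockD blockN; exact: h.
apply: le_trans (prox_error (grad f y1 + F x1, 0) first_block_cpc sub) _.
by apply: le_trans (enorm_pair _) _; rewrite /= addr0 enorm0 addr0.
Qed.

Hypothesis sM : self_adjoint M.

(** Monotonicity of the subdifferential of [p] between [y1] and a solution.  The
    gradient of [f] is taken at [y0], which costs a quarter of the squared
    [Sigma]-norm of the step; the multiplier [x0 + sigma *: e1] and the solution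
    have the same image under [G], so [G] drops out of their pairing. *)
Lemma one_step_inequality xb yb zb : 0 < tau * sigma ->
  KKT p f F G b c (xb, (yb, zb)) ->
  inner (x1 - xb) (x1 - xb) + tau * sigma * (inner (y1 - yb) (M (y1 - yb))
    + (2 - tau) * sigma * inner e1 e1)
  <= inner (x0 - xb) (x0 - xb) + tau * sigma * (inner (y0 - yb) (M (y0 - yb))
    - inner (y1 - y0) (B (y1 - y0)) + 2 * inner dh (y1 - yb)).
Proof.
move=> ts0 [[gb hgb gb0] Gxb ryb].
have mono : 0 <= inner (g - binj Y ord0 gb) (y1 - yb).
  have := subdiff_monotone Hsub hgb.
  by rewrite {2}supported_first_block -linearB inner_binj blockD blockN.
have maj := majorized_gradient y1 cf (gradP y0) (gradP yb) (mf^~ y0) (mf^~ yb).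
pose xi := x0 + sigma *: e1 - xb.
have Gxi : G xi = 0.
  rewrite /xi linearB /= linearD /= linearZ /= HG0 HG1 scaler0 addr0.
  by rewrite -opprB Gxb oppr0.
have pair_xi : inner (F xi) (y1 - yb) = inner xi e1.
  have -> : inner xi e1 = inner xi (adj F (y1 - yb)) + inner xi (adj G (z1 - zb)).
    rewrite -innerDr; congr (inner _ _).
    rewrite [adj F (y1 - yb)]linearB [adj G (z1 - zb)]linearB /= -ryb; vring.
  by rewrite -[inner xi (adj G _)]adjP Gxi inner0l addr0 adjP.
have gdiff : g - binj Y ord0 gb =
    dh - (grad f y0 - grad f yb) - F xi - M (y1 - y0).
  have -> : F xi = F (x0 + sigma *: e1) - F xb by rewrite linearB.
  have -> : binj Y ord0 gb = 0 - grad f yb - F xb.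
    by rewrite -gb0; move: (binj _ _ _) (F _) => ? ?; vring.
  rewrite Hg; by move: (F _) (F _) (M _) => ? ? ?; vring.
move: mono; rewrite gdiff.
have e1E : x1 - xb = (x0 - xb) + (tau * sigma) *: e1 by rewrite Hx addrAC.
have xiE : xi = (x0 - xb) + sigma *: e1 by rewrite /xi addrAC.
have yE : y1 - yb = (y0 - yb) + (y1 - y0) by rewrite [RHS]addrC subrKA.
have BE : inner (y1 - y0) (B (y1 - y0)) = inner (y1 - y0) (M (y1 - y0))
   - 2^-1 * inner (y1 - y0) (Sigma (y1 - y0)).
  rewrite /opB; move: M => A.
  by rewrite add_lfunE opp_lfunE scale_lfunE innerDr innerNr innerZr.
have quad : inner (y1 - yb) (M (y1 - yb)) = inner (y0 - yb) (M (y0 - yb))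
   + 2 * inner (M (y1 - y0)) (y1 - yb) - inner (y1 - y0) (M (y1 - y0)).
  rewrite yE; move: (y0 - yb) (y1 - y0) => a h.
  have sah := (self_adjointP M).1 sM a h; move: M sah => A sah.
  rewrite linearD /= !innerE (innerC (A h) h) (innerC (A h) a) -sah.
  by rewrite (innerC h (A a)); ring.
rewrite 3!innerDl 3!innerNl pair_xi BE quad => mono.
rewrite e1E; move: mono maj; rewrite xiE.
move: (x0 - xb) (inner (grad f y0 - _) _) => t gr.
move: (inner dh _) (inner (M _) (y1 - yb)) => dy my.
move: (inner (y1 - y0) (M _)) (inner (y1 - y0) (Sigma _)) (inner (y0 - yb) _).
move: (e1) => e mm ss ma; rewrite !innerE (innerC e t).
move: (inner t t) (inner t e) (inner e e) => tt te ee mono maj.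
have h1 := mulr_ge0 (ltW ts0) mono.
have h2 : 0 <= tau * sigma * (gr + 4^-1 * ss).
  by apply: mulr_ge0; [exact: ltW | rewrite -lerBlDr sub0r].
rewrite -subr_ge0.
set lhs := (X in 0 <= X).
suff -> : lhs = 2 * (tau * sigma * (dy - gr - (te + sigma * ee) - my))
    + 2 * (tau * sigma * (gr + 4^-1 * ss)).
  by apply: addr_ge0; apply: mulr_ge0.
by rewrite /lhs; field.
Qed.
End OneStep.

(** * The sweeps of the algorithm as one proximal step *)

Section Algorithm.
Variables (R : realType) (X Z : euclidType R) (n : nat) (Y : 'I_n.+1 -> euclidType R).
Local Notation prodY := {dffun forall i, Y i}.
Variables (p : Y ord0 -> \bar R) (f : prodY -> R) (Sigma : 'End(prodY)).
Variables (F : 'Hom(X, prodY)) (G : 'Hom(X, Z)) (b : Z) (c : X).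
Variables (sigma tau : R) (D : forall i, 'End(Y i)) (eps : nat -> R).
Variables (x : nat -> X) (y yh : nat -> prodY) (z : nat -> Z) (dt d : nat -> prodY).
Hypotheses (cpc : closed_proper_convex p).
Hypotheses (sS : self_adjoint Sigma) (pS : psd Sigma) (sigma0 : 0 < sigma).
Hypothesis sD : forall i, self_adjoint (D i).
Hypothesis pdD : forall i, pd (2^-1 *: block Sigma i i
  + sigma *: ((bproj Y i \o F) \o adj (bproj Y i \o F))%VF + D i).
Hypothesis alg : sGS_iPADMM p f Sigma F G b c sigma tau D eps x y yh z dt d.

Local Notation N := (opN Sigma F sigma D).
Local Notation NsGS := (opNsGS Sigma F sigma D).
Local Notation M := (opM Sigma F G sigma D).
Local Notation e k := (adj F (y k) + adj G (z k) - c).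

(** The error of the two sweeps when they are seen as one step in all blocks. *)
Definition sweep_error k : prodY :=
  d k + (upper_part N \o (diag_part N)^-1)%VF (d k - dt k).

Lemma smooth_auglag_grad_opN zz xx (y' w : prodY) :
  smooth_auglag_grad f Sigma F G c sigma zz xx y' w + bdiag D (w - y') =
  smooth_auglag_grad f Sigma F G c sigma zz xx y' y' + N (w - y').
Proof.
rewrite /smooth_auglag_grad opNE subrr linear0.
have -> : adj F w + adj G zz - c = (adj F y' + adj G zz - c) + adj F (w - y').
  by rewrite linearB /=; vring.
rewrite [F (_ + adj F _)]linearD /=.
by move: (F _) (F _) (F _) (Sigma _) (bdiag D _) => *; vring.
Qed.

(** The two sweeps amount to a single inexact proximal step for the augmented
    Lagrangian, whose metric has the additional term [opNsGS]. *)
Lemma sGS_optimality k : exists g : prodY,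
  [/\ subdiff p (y k.+1 ord0) (g ord0), forall i, i != ord0 -> g i = 0 &
   g = sweep_error k - (smooth_auglag_grad f Sigma F G c sigma (z k) (x k) (y k) (y k)
       + N (y k.+1 - y k) + NsGS (y k.+1 - y k))].
Proof.
have [_ _ cvp] := cpc.
pose q := smooth_auglag_grad f Sigma F G c sigma (z k) (x k) (y k).
have [h hh hd] := (sGS_forward alg k ord0).2.
pose g := binj Y ord0 (h - q (bmix (y k.+1) (y k.+1 ord0) (yh k)) ord0).
have lookE i (a w : prodY) : (a + bdiag D (w - y k)) i = a i + D i (w i - y k i).
  by rewrite blockD bdiagE blockD blockN.
have back i : i != ord0 -> dt k i = (q (y k) + N (bmix (y k) (yh k i) (yh k) - y k)) i.
  move=> i0; have [_ [h' hh' <-]] := sGS_backward alg k i0.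
  have -> := auglag_subdiff_smooth_block cvp sS i0 hh'.
  by rewrite -smooth_auglag_grad_opN lookE bmix_eq.
have fwd i : d k i = (g + q (y k) + N (bmix (y k.+1) (y k.+1 i) (yh k) - y k)) i.
  rewrite -addrA -smooth_auglag_grad_opN blockD lookE bmix_eq.
  have [->|i0] := eqVneq i ord0.
    by rewrite /g binj_same -hd addrA subrK.
  rewrite /g binj_other 1?eq_sym// add0r.
  have [_ [h' hh' <-]] := sGS_forward alg k i.
  by have -> := auglag_subdiff_smooth_block cvp sS i0 hh'.
have g0 i : i != ord0 -> g i = 0 by move=> i0; rewrite binj_other// eq_sym.
have saN := self_adjoint_opN F sigma sS sD.
have kN : lker (diag_part N) == 0%VS by apply: pd_lker; exact: diag_part_pd.
have := sGS_decomposition saN kN back fwd g0 (sGS_dt0 alg k).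
rewrite -/(sweep_error k) => <-.
exists g; split=> //; first by rewrite /g binj_same; exact: auglag_subdiff_first_block hh.
rewrite -/q /opNsGS; move: (q _) (N _) ((upper_part N \o _ \o _)%VF _) => a r S.
by vring.
Qed.
End Algorithm.

(** * The seminorm of Omega and its distance *)

Section Distances.
Variables (R : realType).

(** A bound by an increasing quadratic over a set of nonnegative numbers passes
    to the infimum, attained or not. *)
Lemma quadratic_inf (S : set R) (a al be ga : R) : S !=set0 ->
  (forall t, S t -> 0 <= t) -> 0 <= al -> 0 <= be ->
  (forall t, S t -> a <= al * t ^+ 2 + be * t + ga) ->
  a <= al * inf S ^+ 2 + be * inf S + ga.
Proof.
move=> S0 Spos al0 be0 h; have lb : has_lbound S by exists 0 => t /Spos.
have i0 : 0 <= inf S by apply: lb_le_inf => // t /Spos.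
rewrite -subr_le0.
apply: (@le0_of_small_steps _ _ (al * (2 * inf S + 1) + be)) => e /andP[e0 e1].
have [t St te] := inf_adherent e0 (conj S0 lb).
have t0 := Spos _ St; have := h t St.
have : t ^+ 2 <= (inf S + e) ^+ 2.
  by rewrite ler_sqr ?nnegrE ?addr_ge0// ?ltW.
move=> /(ler_wpM2l al0) h1; have h2 := ler_wpM2l be0 (ltW te).
have h3 : al * (e * e) <= al * (e * 1) by rewrite ler_wpM2l// ler_wpM2l// ltW.
move: h1 h2 h3; move: (inf S) => i; rewrite sqrrD; lra.
Qed.
End Distances.

Section Omega.
Variables (R : realType) (X Z : euclidType R) (n : nat) (Y : 'I_n.+1 -> euclidType R).
Local Notation prodY := {dffun forall i, Y i}.
Variables (Sigma : 'End(prodY)) (F : 'Hom(X, prodY)) (G : 'Hom(X, Z)).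
Variables (sigma tau : R) (D : forall i, 'End(Y i)).
Local Notation M := (opM Sigma F G sigma D).
Local Notation Om := (opOmega Sigma F G sigma tau D).
Local Notation c3 := ((2 - tau) * sigma / 3).

Lemma opOmega_form (u : X * (prodY * Z)) : inner u (Om u) = inner u.1 u.1 +
  tau * sigma * (inner u.2.1 (M u.2.1)
    + c3 * inner (opAadj F G u.2) (opAadj F G u.2)).
Proof.
case: u => xx [yy zz]; rewrite inner_pairE /=; congr (_ + _).
rewrite /opTheta innerZr; congr (_ * _); rewrite innerDr innerZr innerDr.
rewrite -(inner_opT _ _ _ _ _ (yy, zz)); congr (_ + _ * _).
  by rewrite !inner_pairE /= !inner0r !addr0 addrC.
by rewrite inner_pairE /= -!adjPr -innerDl.
Qed.

(** The seminorm sees [z] only through [adj G z]. *)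
Lemma opOmega_form_range_proj xx yy zz w :
  inner ((xx, (yy, range_proj G zz)) - w) (Om ((xx, (yy, range_proj G zz)) - w)) =
  inner ((xx, (yy, zz)) - w) (Om ((xx, (yy, zz)) - w)).
Proof.
case: w => x' [y' z']; rewrite !opOmega_form /=.
have E : adj G (range_proj G zz - z') = adj G (zz - z').
  by rewrite [LHS]linearB [RHS]linearB /= adj_range_proj.
by rewrite /opAadj /= E.
Qed.

Lemma odist_range_proj (K : set (X * (prodY * Z))) xx yy zz :
  odist Om (xx, (yy, zz)) K = odist Om (xx, (yy, metric_proj (range G) zz)) K.
Proof.
rewrite /odist; congr (inf _); apply: eq_imagel => w _.
by rewrite metric_proj_range /onorm opOmega_form_range_proj.
Qed.

Hypotheses (sS : self_adjoint Sigma) (pS : psd Sigma) (sigma0 : 0 < sigma).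
Hypothesis tau02 : 0 < tau < 2.
Hypothesis sD : forall i, self_adjoint (D i).
Hypothesis pdD : forall i, pd (2^-1 *: block Sigma i i
  + sigma *: ((bproj Y i \o F) \o adj (bproj Y i \o F))%VF + D i).
Hypothesis psdD : psd (bdiag D + 2^-1 *: Sigma).

Lemma ts_gt0 : 0 < tau * sigma.
Proof. by case/andP: tau02 => t0 _; rewrite mulr_gt0. Qed.
Lemma c3_gt0 : 0 < c3.
Proof. by case/andP: tau02 => _ t2; rewrite divr_gt0// mulr_gt0// subr_gt0. Qed.

Lemma opM_psd : psd M.
Proof.
move=> v; apply: (@le_trans _ _ (inner v (opB Sigma F G sigma D v))).
  exact: opB_psd.
exact: opM_ge_opB.
Qed.

Lemma opOmega_ge0 u : 0 <= inner u (Om u).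
Proof.
rewrite opOmega_form addr_ge0 ?inner_ge0// mulr_ge0 ?(ltW ts_gt0)//.
by rewrite addr_ge0 ?opM_psd// mulr_ge0 ?inner_ge0// ltW// c3_gt0.
Qed.

Lemma onorm_sqr u : onorm Om u ^+ 2 = inner u (Om u).
Proof. by rewrite sqr_sqrtr ?opOmega_ge0. Qed.

Lemma odist_ge0 u K : K !=set0 -> 0 <= odist Om u K.
Proof.
move=> [u0 Ku0]; apply: lb_le_inf; first by exists (onorm Om (u - u0)); exists u0.
by move=> _ [w _ <-]; exact: sqrtr_ge0.
Qed.

Lemma odist_le u u' K : K u' -> odist Om u K ^+ 2 <= inner (u - u') (Om (u - u')).
Proof.
move=> Ku'; rewrite -onorm_sqr ler_sqr ?nnegrE ?sqrtr_ge0//; last first.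
  by apply: odist_ge0; exists u'.
apply: ge_inf; first by exists 0 => _ [w _ <-]; exact: sqrtr_ge0.
by exists u'.
Qed.

(** [opB_coercive], since [opM] dominates [opB] and the residual term occurs in
    the form with the positive factor [c3]. *)
Lemma opOmega_controls_y : exists2 C : R, 0 < C &
  forall u, inner u.2.1 u.2.1 <= C * inner u (Om u).
Proof.
have [C C0 hC] := opB_coercive G sS pS sigma0 sD pdD psdD.
have t0 := ts_gt0; have c0 := c3_gt0.
pose C' := C * ((tau * sigma)^-1 + (tau * sigma * c3)^-1).
have tc0 : 0 < tau * sigma * c3 by rewrite mulr_gt0.
exists C' => [|[xx [yy zz]]].
  by rewrite mulr_gt0// addr_gt0// invr_gt0.
rewrite opOmega_form /=.
apply: (@le_trans _ _ (inner yy yy + inner (range_proj G zz) (range_proj G zz))).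
  by rewrite lerDl inner_ge0.
apply: le_trans (hC yy zz) _; rewrite /C' -mulrA ler_pM2l//.
have B0 : 0 <= inner yy (opB Sigma F G sigma D yy) by exact: opB_psd.
have BM : inner yy (opB Sigma F G sigma D yy) <= inner yy (M yy) by exact: opM_ge_opB.
have := inner_ge0 xx; have := inner_ge0 (opAadj F G (yy, zz)).
rewrite /opAadj /=; move: (inner yy (M yy)) (inner yy _) B0 BM => m q q0 qm.
move: (inner (_ + _) _) (inner xx xx) => a i a0 i0.
have m0 := le_trans q0 qm.
move: (tau * sigma) c3 t0 c0 tc0 => t w t0 w0 tw0.
have -> : (t^-1 + (t * w)^-1) * (i + t * (m + w * a))
  = (m + w * a) + (w^-1 * m + a) + t^-1 * i + (t * w)^-1 * i.
  by field; rewrite !gt_eqF.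
have e3 : 0 <= t^-1 * i by rewrite mulr_ge0// invr_ge0 ltW.
have e4 : 0 <= (t * w)^-1 * i by rewrite mulr_ge0// invr_ge0 ltW.
have e5 : 0 <= w * a by rewrite mulr_ge0// ltW.
have e6 : 0 <= w^-1 * m by rewrite mulr_ge0// invr_ge0 ltW.
lra.
Qed.

Lemma opOmega_bounded : exists2 C : R, 0 < C &
  forall u, inner u (Om u) <= C * inner u u.
Proof.
have [C1 C10 h1] := form_bounded M.
have [C2 C20 h2] := hom_bounded (adj F).
have [C3 C30 h3] := hom_bounded (adj G).
have t0 := ts_gt0; have c0 := c3_gt0.
pose K := C1 + c3 * (2 * C2 ^+ 2 + 2 * C3 ^+ 2).
have K0 : 0 < K by rewrite addr_gt0// mulr_gt0// addr_gt0// mulr_gt0// exprn_gt0.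
exists (1 + tau * sigma * K) => [|[xx [yy zz]]].
  by rewrite addr_gt0// mulr_gt0.
rewrite opOmega_form 2!inner_pairE /= [leRHS]mulrDl mul1r lerD//.
  by rewrite lerDl addr_ge0 ?inner_ge0.
rewrite -[leRHS]mulrA ler_pM2l//.
have y0 := inner_ge0 yy; have z0 := inner_ge0 zz; have x0 := inner_ge0 xx.
have k2 := inner_le_sqr (ltW C20) (h2 yy).
have k3 := inner_le_sqr (ltW C30) (h3 zz).
have k4 : inner (adj F yy + adj G zz) (adj F yy + adj G zz)
   <= 2 * inner (adj F yy) (adj F yy) + 2 * inner (adj G zz) (adj G zz).
  have := inner_ge0 (adj F yy - adj G zz); rewrite !innerE (innerC (adj G zz)); lra.
set nn := inner xx xx + _.
have n1 : C1 * inner yy yy <= C1 * nn by rewrite ler_pM2l// /nn; lra.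
have n2 : C2 ^+ 2 * inner yy yy <= C2 ^+ 2 * nn.
  by rewrite ler_pM2l ?exprn_gt0// /nn; lra.
have n3 : C3 ^+ 2 * inner zz zz <= C3 ^+ 2 * nn.
  by rewrite ler_pM2l ?exprn_gt0// /nn; lra.
rewrite /K [leRHS]mulrDl lerD//; first exact: le_trans (h1 _) n1.
rewrite -[leRHS]mulrA ler_pM2l// /opAadj /=; lra.
Qed.

(** The parallelogram identity, the form being nonnegative at [u - u']. *)
Lemma opOmega_triangle u u' :
  inner (u + u') (Om (u + u')) <= 2 * inner u (Om u) + 2 * inner u' (Om u').
Proof.
have p0 := opOmega_ge0 (u - u'); move: p0; rewrite !opOmega_form.
have AD w w' : opAadj F G (w + w') = opAadj F G w + opAadj F G w'.
  by rewrite /opAadj /= !linearD /= addrACA.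
have AN w : opAadj F G (- w) = - opAadj F G w.
  by rewrite /opAadj /= !linearN /= opprD.
rewrite !AD AN /=; move: (opAadj F G u.2) (opAadj F G u'.2) => a a'.
move: (u.1) (u'.1) (u.2.1) (u'.2.1) => t t' s s'.
rewrite [M (s - s')]linearB [M (s + s')]linearD /=.
move: (M s) (M s') => ms ms'; rewrite !innerE; lra.
Qed.
End Omega.

(** * Decrease and residual along the iterates *)

Section Rate.
Variables (R : realType) (X Z : euclidType R) (n : nat) (Y : 'I_n.+1 -> euclidType R).
Local Notation prodY := {dffun forall i, Y i}.
Variables (p : Y ord0 -> \bar R) (f : prodY -> R) (Sigma : 'End(prodY)).
Variables (F : 'Hom(X, prodY)) (G : 'Hom(X, Z)) (b : Z) (c : X).
Variables (sigma tau : R) (D : forall i, 'End(Y i)) (eps : nat -> R).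
Variables (x : nat -> X) (y yh : nat -> prodY) (z : nat -> Z) (dt d : nat -> prodY).
Hypotheses (cpc : closed_proper_convex p) (cf : convex_real f).
Hypotheses (lf : differentiable_with_lipschitz_grad f).
Hypotheses (sS : self_adjoint Sigma) (pS : psd Sigma) (mf : majorized f Sigma).
Hypotheses (sigma0 : 0 < sigma) (tau02 : 0 < tau < 2).
Hypothesis sD : forall i, self_adjoint (D i).
Hypothesis pdD : forall i, pd (2^-1 *: block Sigma i i
  + sigma *: ((bproj Y i \o F) \o adj (bproj Y i \o F))%VF + D i).
Hypothesis psdD : psd (bdiag D + 2^-1 *: Sigma).
Hypothesis alg : sGS_iPADMM p f Sigma F G b c sigma tau D eps x y yh z dt d.
Hypothesis Gx0 : b - G (x 0%N) = 0.
Hypothesis gam0 : forall k, gamma F G b c sigma x y z k = 0.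

Local Notation M := (opM Sigma F G sigma D).
Local Notation B := (opB Sigma F G sigma D).
Local Notation Om := (opOmega Sigma F G sigma tau D).
Local Notation K := (KKT p f F G b c).
Local Notation u k := (x k, (y k, z k)).
Local Notation v k := (x k, (y k, range_proj G (z k))).
Local Notation e k := (adj F (y k) + adj G (z k) - c).
Local Notation dh := (sweep_error Sigma F sigma D dt d).
Local Notation c3 := ((2 - tau) * sigma / 3).

(** As [gamma] vanishes, [G (x k) = b] forces [G (e k.+1) = 0], and then the
    multiplier update keeps [G x] constant. *)
Lemma feasible_iterates k : G (x k) = b /\ G (e k.+1) = 0.
Proof.
have step j : G (x j) = b -> G (e j.+1) = 0.
  move=> Gx; have := gam0 j; rewrite /gamma Gx subrr add0r => /eqP.
  by rewrite scaler_eq0 gt_eqF//= => /eqP.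
elim: k => [|k [Gx Ge]].
  by split; [|apply: step]; apply/esym/eqP; rewrite -subr_eq0 Gx0.
have Gx1 : G (x k.+1) = b.
  by rewrite (sGS_x alg) linearD /= linearZ /= Ge scaler0 addr0.
by split=> //; exact: step.
Qed.

(** Both residuals [e k] and [e k.+1] lie in the kernel of [G], so the change of
    [adj G z] is opposite to the projection of the change of [adj F y] on the range
    of [adj G].  Hence evaluating the sweep at [z k] instead of [z k.+1] only adds a
    proximal term in [y]. *)
Lemma proximal_optimality k : (0 < k)%N -> exists g : prodY,
  [/\ subdiff p (y k.+1 ord0) (g ord0), forall i, i != ord0 -> g i = 0 &
   g = dh k - grad f (y k) - F (x k + sigma *: e k.+1) - M (y k.+1 - y k)].
Proof.
case: k => // k _; have [g [hs g0 gE]] := sGS_optimality cpc sS pS sD pdD alg k.+1.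
exists g; split=> //; rewrite gE opNE opME /smooth_auglag_grad subrr linear0 addr0.
have Ge1 := (feasible_iterates k).2; have Ge2 := (feasible_iterates k.+1).2.
set y0 := y k.+1 in Ge1 *; set y1 := y k.+2 in Ge2 *.
set z0 := z k.+1 in Ge1 *; set z1 := z k.+2 in Ge2 *.
have eE : adj F (y1 - y0) + adj G (z1 - z0)
    = (adj F y1 + adj G z1 - c) - (adj F y0 + adj G z0 - c).
  by rewrite [adj F (y1 - y0)]linearB [adj G (z1 - z0)]linearB /=; vring.
have : coimage_proj G (adj F (y1 - y0)) = - adj G (z1 - z0).
  rewrite -[adj F _](addrK (adj G (z1 - z0))) eE.
  rewrite linearB /= coimage_proj_adj coimage_projE linearB /= Ge1 Ge2 subrr.
  by rewrite !linear0 add0r.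
move=> ->.
have -> : adj F y1 + adj G z1 - c = (adj F y0 + adj G z0 - c)
    + adj F (y1 - y0) + adj G (z1 - z0).
  by rewrite -[RHS]addrA eE [RHS]addrC subrK.
have FE a a' a'' : F (x k.+1 + sigma *: (a + a' + a'')) =
    F (x k.+1) + sigma *: (F a + F a' + F a'').
  rewrite [F (x _ + _)]linearD /= [F (sigma *: _)]linearZ /= [F (_ + a'')]linearD /=.
  by rewrite [F (a + a')]linearD.
rewrite FE.
rewrite [F (- _)]linearN /=.
move: (F _) (F _) (F _) (F _) (Sigma _) (bdiag D _) (opNsGS _ _ _ _ _) (grad f _) (dh _).
by move=> *; vring.
Qed.

(** In [one_step_inequality] the squared residual [e k.+1] has the factor [3 * c3].
    One third of it goes into the seminorm at [u k.+1].  The remaining two thirds,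
    together with the residual term of the seminorm at [u k], bound the change of
    [x] and the change of the residual; with the form of [opB], the latter bounds
    the change of [y] and of the projection of [z]. *)
Lemma sufficient_decrease : exists2 a : R, 0 < a &
  forall k ub, (0 < k)%N -> K ub ->
  inner (u k.+1 - ub) (Om (u k.+1 - ub)) <= inner (u k - ub) (Om (u k - ub))
   - a * enorm (v k - v k.+1) ^+ 2
   + 2 * (tau * sigma) * inner (dh k) (y k.+1 - ub.2.1).
Proof.
have sM : self_adjoint M by exact: self_adjoint_opM.
have [C C0 hC] := opB_coercive G sS pS sigma0 sD pdD psdD.
have t0 : 0 < tau * sigma := ts_gt0 sigma0 tau02.
have w0 : 0 < c3 := c3_gt0 sigma0 tau02.
have tw0 : 0 < tau * sigma * c3 by rewrite mulr_gt0.
(* the two summands of [K0] make its product with the decrease dominate, in this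
   order, the multiples of the squared residuals and of the form of [opB] *)
pose K0 := ((tau * sigma) ^+ 2 + 2 * C) / (tau * sigma * c3) + C / (tau * sigma).
have K00 : 0 < K0.
  by apply: addr_gt0; apply: divr_gt0 => //; rewrite addr_gt0 ?exprn_gt0 ?(mulr_gt0 _ C0).
exists K0^-1 => [|k [xb [yb zb]] k0 Kub]; first by rewrite invr_gt0.
have [g [hs g0 gE]] := proximal_optimality k0.
have [Gx Ge1] := feasible_iterates k.
have Ge0 : G (e k) = 0.
  by case: k k0 {Gx Ge1 g hs g0 gE} => // k _; exact: (feasible_iterates k).2.
have := one_step_inequality cf lf.1 mf (sGS_x alg k) gE hs g0 Gx Ge1 sM t0 Kub.
have [_ _ ryb] := Kub.
have eAk j : opAadj F G ((y j, z j) - (yb, zb)) = e j.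
  rewrite /opAadj /= [adj F (_ - _)]linearB [adj G (_ - _)]linearB /= -ryb.
  by vring.
rewrite !opOmega_form !eAk /=.
have := hC (y k - y k.+1) (z k - z k.+1).
have -> : inner (y k - y k.+1) (B (y k - y k.+1)) = inner (y k.+1 - y k) (B (y k.+1 - y k)).
  by rewrite -opprB linearN /= innerNl innerNr opprK.
have -> : adj F (y k - y k.+1) + adj G (z k - z k.+1) = e k - e k.+1.
  by rewrite [adj F (_ - _)]linearB [adj G (_ - _)]linearB /=; vring.
rewrite enorm_sqr_triple /=.
have -> : x k - x k.+1 = - ((tau * sigma) *: e k.+1).
  by rewrite (sGS_x alg k); vring.
rewrite -[range_proj G (z k) - _]linearB /= innerNl innerNr opprK innerZl innerZr.
have : inner (e k - e k.+1) (e k - e k.+1) <= 2 * inner (e k) (e k) + 2 * inner (e k.+1) (e k.+1).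
  have := inner_ge0 (e k + e k.+1).
  by move: (e k) (e k.+1) => a a'; rewrite !innerE (innerC a' a); lra.
have B0 : 0 <= inner (y k.+1 - y k) (B (y k.+1 - y k)) by exact: opB_psd.
have := inner_ge0 (e k); have := inner_ge0 (e k.+1).
move: (inner (_ - _) (B _)) B0 => q q0.
move: (inner (e k - e k.+1) _) (inner (e k) _) (inner (e k.+1) _) => ed e0 e1.
move: (inner (y k - _) _) (inner (range_proj G _) _) => dy dz.
move=> n1 n0 hed hd step.
have w3 : (2 - tau) * sigma = 3 * c3 by field.
move: step; rewrite w3; rewrite /K0 in K00 *.
move: (tau * sigma) c3 t0 w0 tw0 K00 => t w t0 w0 tw0 K00 step.
suff key : ((t ^+ 2 + 2 * C) / (t * w) + C / t)^-1 * (t * (t * e1) + (dy + dz))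
    <= t * (w * e0 + 2 * (w * e1) + q) by lra.
rewrite mulrC ler_pdivrMr//.
have -> : t * (w * e0 + 2 * (w * e1) + q) * ((t ^+ 2 + 2 * C) / (t * w) + C / t)
  = (t ^+ 2 + 2 * C) * (e0 + 2 * e1 + q / w) + C * (w * (e0 + 2 * e1) + q).
  by field; rewrite !gt_eqF.
have r1 : C * (q + ed) <= C * (q + (2 * e0 + 2 * e1)) by rewrite ler_pM2l// lerD2l.
have r2 : 0 <= t ^+ 2 * (e0 + e1) by rewrite mulr_ge0 ?exprn_ge0 ?addr_ge0// ltW.
have r3 : 0 <= (t ^+ 2 + 2 * C) * (q / w).
  by rewrite mulr_ge0 ?divr_ge0 ?addr_ge0 ?exprn_ge0 ?mulr_ge0// ltW.
have r4 : 0 <= C * (w * (e0 + 2 * e1)).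
  by rewrite !mulr_ge0 ?addr_ge0 ?mulr_ge0// ltW.
have r5 : 0 <= C * e1 by rewrite mulr_ge0// ltW.
rewrite expr2 in r2 r3 *; lra.
Qed.

Lemma sweep_error_bounded : exists2 C : R, 0 < C & forall k (r : R),
  (forall i, Num.max (enorm (dt k i)) (enorm (d k i)) <= r) ->
  enorm (dh k) <= C * r.
Proof.
have sum_blocks (a : prodY) (r : R) : (forall i, enorm (a i) <= r) ->
    enorm a <= n.+1%:R * r.
  move=> h; rewrite (sum_binj a); apply: le_trans (enorm_sum _ _ _) _.
  apply: (@le_trans _ _ (\sum_(i < n.+1) r)).
    by apply: ler_sum => i _; rewrite /enorm inner_binj binj_same; exact: h.
  by rewrite sumr_const card_ord mulr_natl.
have [C C0 hC] := hom_bounded (upper_part (opN Sigma F sigma D) \o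
   (diag_part (opN Sigma F sigma D))^-1)%VF.
exists (n.+1%:R + C * (2 * n.+1%:R)); first by rewrite addr_gt0// !mulr_gt0.
move=> k r h.
have hd : enorm (d k) <= n.+1%:R * r.
  by apply: sum_blocks => i; have := h i; rewrite ge_max => /andP[].
have hdt : enorm (dt k) <= n.+1%:R * r.
  by apply: sum_blocks => i; have := h i; rewrite ge_max => /andP[].
apply: le_trans (enormD _ _) _; rewrite mulrDl lerD//.
apply: le_trans (hC _) _; rewrite -!mulrA ler_pM2l//.
by apply: le_trans (enormB _ _) _; lra.
Qed.

(** [proximal_optimality] expresses the subgradient at [y k.+1] by the data at step
    [k]; it differs from minus the gradient at step [k.+1] by the sweep error and
    by Lipschitz functions of the step. *)
Lemma residual_bounded : exists2 C : R, 0 < C & forall k, (0 < k)%N ->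
  enorm (kkt_residual p f F G b c (v k.+1))
  <= C * (enorm (v k - v k.+1) + enorm (dh k)).
Proof.
have t0 : 0 < tau * sigma := ts_gt0 sigma0 tau02.
have tau0 : 0 < tau by case/andP: tau02.
have [L hL] := lf.2.
have [C1 C10 h1] := hom_bounded F; have [C2 C20 h2] := hom_bounded M.
pose ts := tau * sigma.
exists (ts^-1 + 1 + `|L| + C1 * (1 + tau^-1) + C2) => [|k k0].
  have i0 : 0 < ts^-1 by rewrite invr_gt0.
  have i1 : 0 < C1 * (1 + tau^-1) by rewrite mulr_gt0// addr_gt0 ?invr_gt0.
  by have := normr_ge0 L; lra.
have [g [hs g0 gE]] := proximal_optimality k0.
have [Gx Ge1] := feasible_iterates k.
have := kkt_residual_bound cpc lf.1 (sGS_x alg k) hs g0 Gx Ge1 (adj_range_proj G (z k.+1)).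
move=> h; apply: le_trans h _.
have eE : e k.+1 = ts^-1 *: (x k.+1 - x k).
  have -> : x k.+1 - x k = ts *: e k.+1.
    by rewrite (sGS_x alg k) [LHS]addrAC subrr add0r.
  by rewrite scalerA mulVf ?gt_eqF// scale1r.
set dv := enorm (v k - v k.+1).
have dx : enorm (x k.+1 - x k) <= dv by rewrite enormBC; exact: (enorm_fst (v k - v k.+1)).
have dy : enorm (y k.+1 - y k) <= dv.
  rewrite enormBC; apply: le_trans (enorm_snd (v k - v k.+1)).
  exact: (enorm_fst (v k - v k.+1).2).
have gfE : g + (grad f (y k.+1) + F (x k.+1)) = dh k + (grad f (y k.+1) - grad f (y k))
   + F ((x k.+1 - x k) - sigma *: e k.+1) - M (y k.+1 - y k).
  have -> : x k.+1 - x k - sigma *: e k.+1 = x k.+1 - (x k + sigma *: e k.+1).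
    by rewrite opprD addrA.
  by rewrite gE [F (_ - _)]linearB /=; move: (F _) (F _) (M _) => *; vring.
rewrite gfE {gfE}.
have n1 : enorm (e k.+1) <= ts^-1 * dv.
  by rewrite eE enormZ gtr0_norm ?invr_gt0// ler_pM2l ?invr_gt0.
have n2 : enorm (grad f (y k.+1) - grad f (y k)) <= `|L| * dv.
  apply: le_trans (hL _ _) _; apply: le_trans (ler_wpM2r (enorm_ge0 _) (ler_norm L)) _.
  exact: ler_wpM2l.
have n3 : enorm (F ((x k.+1 - x k) - sigma *: e k.+1)) <= C1 * (1 + tau^-1) * dv.
  apply: le_trans (h1 _) _; rewrite -mulrA ler_pM2l//.
  apply: le_trans (enormB _ _) _; rewrite mulrDl mul1r lerD//.
  rewrite enormZ gtr0_norm//; apply: le_trans (ler_wpM2l (ltW sigma0) n1) _.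
  by rewrite mulrA /ts invfM mulrCA divff ?gt_eqF// mulr1.
have n4 : enorm (M (y k.+1 - y k)) <= C2 * dv.
  by apply: le_trans (h2 _) _; rewrite ler_pM2l.
have n5 := enormB (dh k + (grad f (y k.+1) - grad f (y k))
   + F ((x k.+1 - x k) - sigma *: e k.+1)) (M (y k.+1 - y k)).
have n6 := enormD (dh k + (grad f (y k.+1) - grad f (y k)))
   (F ((x k.+1 - x k) - sigma *: e k.+1)).
have n7 := enormD (dh k) (grad f (y k.+1) - grad f (y k)).
have dv0 : 0 <= dv by exact: enorm_ge0.
have r0 : 0 <= enorm (dh k) by exact: enorm_ge0.
apply: le_trans (lerD n1 (le_trans n5 (lerD (le_trans n6 (lerD (le_trans n7
  (lerD (lexx _) n2)) n3)) n4))) _.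
move: (enorm (dh k)) dv dv0 r0 {n1 n2 n3 n4 dx dy} => r t dv0 r0.
have a1 : 0 <= ts^-1 * r by rewrite mulr_ge0 ?invr_ge0 ?(ltW t0).
have a2 : 0 <= `|L| * r by rewrite mulr_ge0.
have a3 : 0 <= C1 * (1 + tau^-1) * r.
  by rewrite !mulr_ge0 ?addr_ge0 ?invr_ge0 ?(ltW C10) ?(ltW tau0).
have a4 : 0 <= C2 * r by rewrite mulr_ge0 ?(ltW C20).
rewrite mulrDr !mulrDl !mul1r; lra.
Qed.
End Rate.

(** * Linear convergence *)

Section Contraction.
Variable R : realType.

(** The scalar recursion behind the rate.  [D0] and [D1] are successive distances
    and [t] is the length of the step: the decrease [a * t ^+ 2] is proportional to
    the square of the distance by [D0 <= C * t], and half of it absorbs the errors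
    when [eta] is small. *)
Lemma contraction_step (a C B eta D0 D1 t : R) : 0 < a -> 0 < C -> 0 <= B ->
  0 <= D0 -> 0 <= D1 -> 0 <= t -> 0 <= eta ->
  D0 <= C * t -> D1 ^+ 2 <= D0 ^+ 2 + B * eta * t * D0 + (B * eta - a) * t ^+ 2 ->
  B * (1 + C) * eta <= a / 2 ->
  D1 <= Num.sqrt (Num.max 0 (1 - a / (2 * C ^+ 2))) * D0.
Proof.
move=> a0 C0 B0 D00 D10 t0 eta0 hD hrec heta.
rewrite -ler_sqr ?nnegrE ?mulr_ge0 ?sqrtr_ge0// exprMn sqr_sqrtr ?le_max ?lexx//.
apply: (@le_trans _ _ ((1 - a / (2 * C ^+ 2)) * D0 ^+ 2)); last first.
  by rewrite ler_wpM2r ?sqr_ge0// le_max lexx orbT.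
have h1 : B * eta * t * D0 <= B * eta * t * (C * t).
  by rewrite ler_wpM2l// !mulr_ge0.
have h2 : B * (1 + C) * eta * t ^+ 2 <= a / 2 * t ^+ 2.
  by rewrite ler_wpM2r ?sqr_ge0.
have h3 : D0 ^+ 2 <= C ^+ 2 * t ^+ 2.
  by rewrite -exprMn ler_sqr ?nnegrE// mulr_ge0// ltW.
have h4 : a / (2 * C ^+ 2) * D0 ^+ 2 <= a / 2 * t ^+ 2.
  apply: (@le_trans _ _ (a / (2 * C ^+ 2) * (C ^+ 2 * t ^+ 2))).
    by rewrite ler_wpM2l// divr_ge0 ?mulr_ge0 ?exprn_ge0// ltW.
  by rewrite le_eqVlt; apply/orP; left; apply/eqP; field; rewrite gt_eqF.
apply: le_trans hrec _; rewrite [leRHS]mulrBl mul1r -addrA lerD2l.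
have h5 : B * eta * t * (C * t) + (B * eta - a) * t ^+ 2
   = B * (1 + C) * eta * t ^+ 2 - a * t ^+ 2 by ring.
lra.
Qed.
End Contraction.

Theorem theorem4p3
    (R : realType) (X Z : euclidType R) (s : nat) (Y : 'I_s.+1 -> euclidType R)
    (p : Y ord0 -> \bar R) (f : {dffun forall i, Y i} -> R)
    (Sigma : 'End({dffun forall i, Y i}))
    (F : 'Hom(X, {dffun forall i, Y i})) (G : 'Hom(X, Z)) (b : Z) (c : X)
    (sigma tau : R) (D : forall i, 'End(Y i)) (eps : nat -> R)
    (x : nat -> X) (y yh : nat -> {dffun forall i, Y i}) (z : nat -> Z)
    (dt d : nat -> {dffun forall i, Y i})
    (vstar : X * ({dffun forall i, Y i} * Z)) :
  let K := KKT p f F G b c in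
  let Om := opOmega Sigma F G sigma tau D in
  let u k : X * ({dffun forall i, Y i} * Z) := (x k, (y k, z k)) in
  let v k : X * ({dffun forall i, Y i} * Z) :=
    (x k, (y k, metric_proj (range G) (z k))) in
  closed_proper_convex p ->
  convex_real f -> differentiable_with_lipschitz_grad f ->
  self_adjoint Sigma -> psd Sigma -> majorized f Sigma ->
  0 < sigma -> 0 < tau < 2 ->
  K !=set0 ->
  (forall i, self_adjoint (D i)) ->
  (forall i, pd (2^-1 *: block Sigma i i
                 + sigma *: ((bproj Y i \o F) \o adj (bproj Y i \o F))%VF
                 + D i)) ->
  psd (bdiag D + 2^-1 *: Sigma) ->
  (forall k, 0 <= eps k) -> cvgn (series eps) ->
  sGS_iPADMM p f Sigma F G b c sigma tau D eps x y yh z dt d ->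
  K vstar ->
  enorm (v k - vstar) @[k --> \oo] --> (0 : R) ->
  (forall k, odist Om (u k) K = odist Om (v k) K) /\
  (b - G (x 0%N) = 0 ->
   (forall k, gamma F G b c sigma x y z k = 0) ->
   forall kappa : R, 0 < kappa ->
   metric_subregular_at p f F G b c vstar kappa ->
   forall (eta : nat -> R) (k0 : nat),
   (forall k, 0 <= eta k) -> eta k @[k --> \oo] --> (0 : R) ->
   (0 < k0)%N ->
   (forall k, (k0 <= k)%N -> forall i,
      Num.max (enorm (dt k i)) (enorm (d k i)) <= eta k * enorm (v k - v k.+1)) ->
   exists theta : nat -> R,
     [/\ forall k, 0 <= theta k,
         (ereal_sup [set (theta k)%:E | k in [set k | (k0 <= k)%N]] < 1%:E)%E &
         \forall k \near \oo,
           odist Om (u k.+1) K <= theta k * odist Om (u k) K]).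
Proof.
move=> K Om u v cpc cf lf sS pS mf sigma0 tau02 K0 sD pdD psdD eps0 _ alg Kv cvv.
have dist_eq k : odist Om (u k) K = odist Om (v k) K by exact: odist_range_proj.
split=> // Gx0 gam0 kappa kappa0 [r r0 subreg] eta k0 eta0 cveta k0pos hsweep.
have t0 : 0 < tau * sigma := ts_gt0 sigma0 tau02.
have [a a0 decr] :=
  sufficient_decrease cpc cf lf sS pS mf sigma0 tau02 sD pdD psdD alg Gx0 gam0.
have [Cs Cs0 hCs] := sweep_error_bounded Sigma F sigma D dt d.
have [Cr Cr0 hCr] := residual_bounded cpc lf sS pS sigma0 tau02 sD pdD alg Gx0 gam0.
have [Cy Cy0 hCy] := opOmega_controls_y G sS pS sigma0 tau02 sD pdD psdD.
have [be be0 hbe] := @opOmega_bounded _ _ _ _ _ Sigma F G sigma tau D sigma0 tau02.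
have vE k : v k = (x k, (y k, range_proj G (z k))).
  by rewrite /v metric_proj_range.
pose t k := enorm (v k - v k.+1).
have tpos k : 0 <= t k by exact: enorm_ge0.
pose C := Num.sqrt (2 * be * ((kappa * Cr * (1 + Cs)) ^+ 2 + 1)) + 1.
pose B := 2 * (tau * sigma) * Cs * (1 + Num.sqrt Cy).
have C0 : 0 < C by rewrite ltr_wpDl ?sqrtr_ge0.
have B0 : 0 < B.
  rewrite !mulr_gt0//; have := sqrtr_ge0 Cy; lra.
have psdOm w : 0 <= inner w (Om w) by exact: opOmega_ge0.
have onormE w : onorm Om w ^+ 2 = inner w (Om w) by exact: onorm_sqr.
have C2 : 2 * be * ((kappa * Cr * (1 + Cs)) ^+ 2 + 1) <= C ^+ 2.
  have h : 0 <= 2 * be * ((kappa * Cr * (1 + Cs)) ^+ 2 + 1).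
    by rewrite !mulr_ge0 ?addr_ge0 ?sqr_ge0// ltW.
  rewrite -[leLHS]sqr_sqrtr// ler_sqr ?nnegrE ?sqrtr_ge0 ?(ltW C0)//.
  by rewrite lerDl ler01.
have qu w k : inner (u k - w) (Om (u k - w)) = inner (v k - w) (Om (v k - w)).
  by rewrite vE /Om opOmega_form_range_proj.
(* metric subregularity at [v k.+1], carried one step back to [u k] by the
   parallelogram inequality; [C] collects the constants *)
have near_step k : (k0 <= k)%N -> eta k <= 1 -> enorm (v k.+1 - vstar) <= r ->
    odist Om (u k) K <= C * t k.
  move=> kk eta1 vr.
  have kpos : (0 < k)%N := leq_trans k0pos kk.
  have hdh : enorm (sweep_error Sigma F sigma D dt d k) <= Cs * t k.
    apply: hCs => i; apply: le_trans (hsweep k kk i) _.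
    by have := ler_wpM2r (tpos k) eta1; rewrite mul1r.
  have hres : Defs.edist (v k.+1) K <= kappa * Cr * (1 + Cs) * t k.
    apply: le_trans (subreg _ vr) _; rewrite -!mulrA ler_pM2l//.
    rewrite vE; apply: le_trans (hCr k kpos) _; rewrite ler_pM2l// -!vE -/(t k).
    by rewrite mulrDl mul1r lerD2l.
  have edpos : 0 <= Defs.edist (v k.+1) K.
    apply: lb_le_inf; first by case: K0 => w Kw; exists (enorm (v k.+1 - w)); exists w.
    by move=> _ [w _ <-]; exact: enorm_ge0.
  have main : odist Om (u k) K ^+ 2 <= 2 * be * Defs.edist (v k.+1) K ^+ 2 +
      0 * Defs.edist (v k.+1) K + 2 * be * t k ^+ 2.
    apply: quadratic_inf => //.
    - by case: K0 => w Kw; exists (enorm (v k.+1 - w)); exists w.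
    - by move=> _ [w _ <-]; exact: enorm_ge0.
    - by rewrite mulr_ge0// ltW.
    move=> _ [w Kw <-]; rewrite mul0r addr0.
    apply: le_trans (odist_le G pS sigma0 tau02 pdD psdD (u k) Kw) _.
    rewrite -/Om qu -[v k - w](subrKA (v k.+1)) addrC.
    apply: le_trans (opOmega_triangle G pS sigma0 tau02 pdD psdD _ _) _.
    by rewrite -!mulrA; apply: lerD; rewrite ler_pM2l// enorm_sqr; exact: hbe.
  rewrite -ler_sqr ?nnegrE ?mulr_ge0 ?(ltW C0)//; last exact: odist_ge0.
  apply: le_trans main _; rewrite mul0r addr0.
  have := ler_wpM2l (ltW be0)
    (_ : Defs.edist (v k.+1) K ^+ 2 <= (kappa * Cr * (1 + Cs) * t k) ^+ 2).
  rewrite ler_sqr ?nnegrE//; last by apply: le_trans hres.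
  move=> /(_ hres); have := ler_wpM2r (sqr_ge0 (t k)) C2; rewrite !exprMn; lra.
(* [sufficient_decrease] for every solution, then the infimum over solutions: the
   error term is linear in the distance from [u k] to the solution *)
have recur k : (k0 <= k)%N ->
    odist Om (u k.+1) K ^+ 2 <= odist Om (u k) K ^+ 2
      + B * eta k * t k * odist Om (u k) K + (B * eta k - a) * t k ^+ 2.
  move=> kk; have kpos : (0 < k)%N := leq_trans k0pos kk.
  have hdh : enorm (sweep_error Sigma F sigma D dt d k) <= Cs * (eta k * t k).
    by apply: hCs => i; exact: hsweep.
  rewrite -[X in X + _ + _]mul1r; apply: quadratic_inf => //.
  - by case: K0 => w Kw; exists (onorm Om (u k - w)); exists w.
  - by move=> _ [w _ <-]; exact: sqrtr_ge0.
  - by rewrite mulr_ge0// mulr_ge0// ltW.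
  move=> _ [w Kw <-]; rewrite mul1r onormE.
  apply: le_trans (odist_le G pS sigma0 tau02 pdD psdD (u k.+1) Kw) _.
  apply: le_trans (decr k w kpos Kw) _; rewrite -!vE -/(t k) -/Om.
  have hy0 : enorm (y k - w.2.1) <= Num.sqrt Cy * onorm Om (u k - w).
    by rewrite /onorm -sqrtrM ?(ltW Cy0)// ler_wsqrtr// (hCy (u k - w)).
  have hy1 : enorm (y k.+1 - y k) <= t k.
    rewrite enormBC; apply: le_trans (enorm_snd (v k - v k.+1)).
    exact: (enorm_fst (v k - v k.+1).2).
  have hy : enorm (y k.+1 - w.2.1) <= t k + Num.sqrt Cy * onorm Om (u k - w).
    rewrite -(subrKA (y k)); apply: le_trans (enormD _ _) _; exact: lerD.
  have := le_trans (cauchy_schwarz (sweep_error Sigma F sigma D dt d k) (y k.+1 - w.2.1))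
    (ler_pM (enorm_ge0 _) (enorm_ge0 _) hdh hy).
  have := sqrtr_ge0 Cy; have : 0 <= onorm Om (u k - w) by exact: sqrtr_ge0.
  have := eta0 k; have := tpos k; rewrite -onormE /B.
  move: (Num.sqrt Cy) (onorm _ _) (eta k) (t k) => s0 o h q q0 h0 o0 s00.
  move=> /(ler_wpM2l (ltW t0)); move: (tau * sigma) t0 => ts ts0.
  have p1 : 0 <= ts * Cs * h * q * o by rewrite !mulr_ge0 ?(ltW ts0) ?(ltW Cs0).
  have p2 : 0 <= ts * Cs * h * q * q * s0 by rewrite !mulr_ge0 ?(ltW ts0) ?(ltW Cs0).
  move: p1 p2; rewrite !expr2; lra.
exists (fun=> Num.sqrt (Num.max 0 (1 - a / (2 * C ^+ 2)))); split.
- by move=> _; exact: sqrtr_ge0.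
- apply: (@le_lt_trans _ _ (Num.sqrt (Num.max 0 (1 - a / (2 * C ^+ 2))))%:E).
    by apply: ub_ereal_sup => _ [k _ <-].
  rewrite lte_fin -[ltRHS]sqrtr1 ltr_sqrt// gt_max ltr01/=.
  by rewrite ltrBlDr ltrDl divr_gt0// mulr_gt0// exprn_gt0.
have cvv' : enorm (v k.+1 - vstar) @[k --> \oo] --> (0 : R).
  by have := cvv; rewrite -(cvg_shiftS (fun k => enorm (v k - vstar))).
have BC0 : 0 < B * (1 + C) by rewrite mulr_gt0// addr_gt0.
have e1 : 0 < Num.min 1 (a / 2 / (B * (1 + C))) by rewrite lt_min ltr01 !divr_gt0.
have /cvgrPdist_le/(_ r r0) near1 := cvv'.
have /cvgrPdist_lt/(_ _ e1) near2 := cveta.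
near=> k.
have kk : (k0 <= k)%N by near: k; exact: nbhs_infty_ge.
have vr : enorm (v k.+1 - vstar) <= r.
  have : `|0 - enorm (v k.+1 - vstar)| <= r by near: k.
  by rewrite sub0r normrN ger0_norm ?enorm_ge0.
have : eta k < Num.min 1 (a / 2 / (B * (1 + C))).
  have : `|0 - eta k| < Num.min 1 (a / 2 / (B * (1 + C))) by near: k.
  by rewrite sub0r normrN ger0_norm.
rewrite lt_min => /andP[eta1 eta2].
apply: (@contraction_step _ a C B (eta k) _ _ (t k)) => //.
- exact: ltW.
- exact: odist_ge0.
- exact: odist_ge0.
- by apply: near_step => //; exact: ltW.
- exact: recur.
- by rewrite mulrC -ler_pdivlMr// ltW.
Unshelve. all: by end_near.
Qed.
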